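(* Let $D, N \ge 1$ be integers and let $(g^*, \lambda^*, \alpha^* )$ (the ground-truth model) and $(g, \lambda, \alpha)$ (the learned model) be two generative models with latent space $\mathbb{R}^D$ and observation space $\mathbb{R}^N$, as defined in the context. Suppose that: (i) the generators $g^*, g : \mathbb{R}^D \to \mathbb{R}^N$ are defined everywhere on $\mathbb{R}^D$, are injective, and are differentiable almost everywhere; (ii) there is no model misspecification, i.e. $\alpha = \alpha^*$ and $\lambda = \lambda^*$, and moreover $\alpha < 2$; thus the law of the latent pair $(\mathbf{z}_{t-1}, \mathbf{z}_t)$ is the same for both models; (iii) pairs of observations are generated as $(\mathbf{x}^*_{t-1}, \mathbf{x}^*_t) = (g^*(\mathbf{z}_{t-1}), g^*(\mathbf{z}_t))$ and $(\mathbf{x}_{t-1}, \mathbf{x}_t) = (g(\mathbf{z}_{t-1}), g(\mathbf{z}_t))$, where $(\mathbf{z}_{t-1}, \mathbf{z}_t)$ is distributed according to the latent prior $p(\mathbf{z}_{t-1}, \mathbf{z}_t)$ with parameters $\lambda, \alpha$; (iv) the distributions of the random pairs $(\mathbf{x}^*_{t-1}, \mathbf{x}^*_t)$ and $(\mathbf{x}_{t-1}, \mathbf{x}_t)$ are the same. Then $g = g^* \circ \sigma$, where $\sigma : \mathbb{R}^D \to \mathbb{R}^D$ is a composition of a permutation of the coordinates and sign flips of coordinates; that is, there exist a permutation $\pi$ of $\{1, \dots, D\}$ and signs $s_1, \dots, s_D \in \{-1, +1\}$ such that $\sigma(\mathbf{z})_i = s_i z_{\pi(i)}$ for all $\mathbf{z}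 \in \mathbb{R}^D$ and all $i$.
   Context: A generative model $(g, \lambda, \alpha)$ with latent space $\mathbb{R}^D$ and observation space $\mathbb{R}^N$ consists of a map (the generator) $g : \mathbb{R}^D \to \mathbb{R}^N$, a rate parameter $\lambda > 0$ and a shape parameter $\alpha > 0$. It describes a pair of latent vectors $(\mathbf{z}_{t-1}, \mathbf{z}_t) \in \mathbb{R}^D \times \mathbb{R}^D$ (two temporally adjacent time steps) with joint density $$p(\mathbf{z}_{t-1}, \mathbf{z}_t) = p(\mathbf{z}_{t-1})\, p(\mathbf{z}_t \mid \mathbf{z}_{t-1}),$$ where $p(\mathbf{z}_{t-1})$ is the density of the standard Gaussian $\mathcal{N}(\mathbf{0}, \mathbf{I})$ on $\mathbb{R}^D$ and the transition density is the factorized generalized Laplace density $$p(\mathbf{z}_t \mid \mathbf{z}_{t-1}) = \prod_{i=1}^D \frac{\alpha\, \lambda^{1/\alpha}}{2\, \Gamma(1/\alpha)} \exp\!\left(-\lambda\, |z_{t,i} - z_{t-1,i}|^{\alpha}\right).$$ The corresponding observations are $\mathbf{x}_{t-1} = g(\mathbf{z}_{t-1})$ and $\mathbf{x}_t = g(\mathbf{z}_t)$ (noise-free). ''Almost everywhere'' on $\mathbb{R}^D$ is with respect to Lebesgue measure.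
   Formalization: The equality g = g*∘σ is proved almost everywhere, and at every z where g is continuous at z and g* at σ(z); equality at every point is false, e.g. g* = identity on R and g = identity with the values at 0 and 1 swapped. *)

(* Defs.v *)
From HB Require Import structures.
From mathcomp Require Import all_boot all_order all_algebra perm.
From mathcomp Require Import all_classical all_reals all_analysis.

Set Implicit Arguments.
Unset Strict Implicit.
Unset Printing Implicit Defensive.

Import Order.TTheory GRing.Theory Num.Theory.
Import numFieldNormedType.Exports.

Local Open Scope classical_set_scope.
Local Open Scope ring_scope.

(* The product sigma-algebra, generated by the coordinates: on R^n it is the
   Borel sigma-algebra. *)
Section measurable_rV.
Variables (R : realType) (n : nat).

Let coord (i : 'I_n) (v : 'rV[R]_n) : R := v ord0 i.

Let rV_set0 : g_sigma_preimage coord set0.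
Proof. exact: sigma_algebra0. Qed.

Let rV_setC A : g_sigma_preimage coord A -> g_sigma_preimage coord (~` A).
Proof. exact: sigma_algebraC. Qed.

Let rV_bigcup (F : (set 'rV[R]_n)^nat) :
  (forall i, g_sigma_preimage coord (F i)) ->
  g_sigma_preimage coord (\bigcup_i F i).
Proof. exact: sigma_algebra_bigcup. Qed.

HB.instance Definition _ := @isMeasurable.Build default_measure_display
  'rV[R]_n (g_sigma_preimage coord) rV_set0 rV_setC rV_bigcup.

Lemma measurable_rV_coord (i : 'I_n) :
  measurable_fun [set: 'rV[R]_n] (fun v : 'rV[R]_n => v ord0 i).
Proof.
move=> _ Y mY; rewrite setTI; apply: sub_sigma_algebra => /=.
rewrite -bigcup_seq/=; exists i => /=; first by rewrite mem_index_enum.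
by exists Y => //; rewrite setTI.
Qed.

Lemma measurable_fun_rVP d (T : measurableType d) (f : T -> 'rV[R]_n) :
  (forall i, measurable_fun [set: T] (fun x => f x ord0 i)) ->
  measurable_fun [set: T] f.
Proof.
move=> mf; suff: g_sigma_preimage (fun i => coord i \o f) `<=` measurable.
  rewrite g_sigma_preimage_comp => S _ A mA.
  by apply: S; exists A.
apply: smallest_sub; first exact: sigma_algebra_measurable.
move=> A; rewrite -bigcup_seq => -[i _ [B mB <-]]; exact: mf.
Qed.

End measurable_rV.

Lemma measurable_row_mx (R : realType) (n : nat) :
  measurable_fun [set: measurableTypeR R * 'rV[R]_n]
    (fun p => row_mx p.1%:M p.2 : 'rV[R]_n.+1).
Proof.
apply: measurable_fun_rVP => i.
case: (split_ordP (i : 'I_(1 + n))) => j ->.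
  rewrite [X in measurable_fun _ X](_ : _ = fst) //; apply/funext => p.
  by apply: etrans (row_mxEl _ _ _ _) _; rewrite !ord1 mxE eqxx mulr1n.
rewrite [X in measurable_fun _ X](_ : _ = (fun v : 'rV[R]_n => v ord0 j) \o snd).
  by apply: measurableT_comp; [exact: measurable_rV_coord|].
by apply/funext => p; exact: row_mxEr.
Qed.

(* Lebesgue measure on R^n, by recursion on n: R^n.+1 carries the image of the
   product measure on R x R^n under concatenation; R^0 is a point of mass 1. *)
Fixpoint lebesgue_rV (R : realType) (n : nat) : set 'rV[R]_n -> \bar R :=
  match n return set 'rV[R]_n -> \bar R with
  | 0%N => \d_(0 : 'rV[R]_0)
  | m.+1 => pushforward (lebesgue_measure \x @lebesgue_rV R m)%E
              (fun p => row_mx p.1%:M p.2 : 'rV[R]_m.+1)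
  end.

Section lebesgue_rV_measure.
Context {R : realType}.

Let row_mx_bij (n : nat) (v : 'rV[R]_n.+1) :
  row_mx (lsubmx (v : 'rV[R]_(1 + n)) ord0 ord0)%:M
    (rsubmx (v : 'rV[R]_(1 + n))) = v.
Proof.
rewrite -[RHS](@hsubmxK _ 1 1 n); congr row_mx.
by apply/rowP => i; rewrite !ord1 mxE eqxx mulr1n.
Qed.

Let sigma_finite_measure_pack d (T : measurableType d) (m : set T -> \bar R) :
  m set0 = 0%E -> (forall A, 0 <= m A)%E -> semi_sigma_additive m ->
  sigma_finite setT m ->
  exists mu : {sigma_finite_measure set T -> \bar R}, m = mu.
Proof.
move=> m0 m_ge0 m_sa m_sf.
pose mM := isMeasure.Build _ _ _ m m0 m_ge0 m_sa.
pose mMT : {measure set T -> \bar R} := HB.pack m mM.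
pose mS := Measure_isSigmaFinite.Build _ _ _ mMT m_sf.
pose mu : {sigma_finite_measure set T -> \bar R} := HB.pack m mM mS.
by exists mu.
Qed.

Let lebesgue_rV_sigma_finite_measure (n : nat) :
  exists mu : {sigma_finite_measure set 'rV[R]_n -> \bar R},
    @lebesgue_rV R n = mu.
Proof.
elim: n => [|n [mu muE]].
  by exists \d_(0 : 'rV[R]_0).
have mf := @measurable_row_mx R n.
pose f (p : measurableTypeR R * 'rV[R]_n) : 'rV[R]_n.+1 := row_mx p.1%:M p.2.
pose h (v : 'rV[R]_n.+1) : measurableTypeR R * 'rV[R]_n :=
  (lsubmx (v : 'rV[R]_(1 + n)) ord0 ord0, rsubmx (v : 'rV[R]_(1 + n))).
have fh v : f (h v) = v by exact: row_mx_bij.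
have hf p : h (f p) = p.
  by rewrite /h /f (@row_mxKl _ 1 1 n) (@row_mxKr _ 1 1 n) mxE eqxx; case: p.
have mh : measurable_fun setT h.
  apply/measurable_fun_pairP; split => /=.
    rewrite [X in measurable_fun _ X](_ : _ = fun v : 'rV[R]_n.+1 =>
      v ord0 (lshift n ord0 : 'I_(1 + n))).
      exact: measurable_rV_coord.
    by apply/funext => v /=; rewrite mxE.
  apply: measurable_fun_rVP => i.
  rewrite [X in measurable_fun _ X](_ : _ = fun v : 'rV[R]_n.+1 =>
    v ord0 (rshift 1 i : 'I_(1 + n))).
    exact: measurable_rV_coord.
  by apply/funext => v /=; rewrite mxE.
pose prod : {measure set (measurableTypeR R * 'rV[R]_n)%type -> \bar R} :=
  (lebesgue_measure \x mu)%E.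
have -> : @lebesgue_rV R n.+1 = pushforward prod f by rewrite /= muE.
have nu0 : pushforward prod f set0 = 0%E by exact: measure0.
have nu_ge0 A : (0 <= pushforward prod f A)%E by exact: measure_ge0.
have nu_sa : semi_sigma_additive (pushforward prod f).
  exact: measure_semi_sigma_additive.
have nu_sf : sigma_finite setT (pushforward prod f).
  have /sigma_finiteP[F [FT ndF Foo]] := sigma_finiteT (@lebesgue_measure R).
  have /sigma_finiteP[G [GT ndG Goo]] := sigma_finiteT mu.
  exists (fun k => h @^-1` (F k `*` G k)).
    rewrite -preimage_bigcup (_ : \bigcup_k _ = setT) ?preimage_setT//.
    apply/seteqP; split => // -[x y] _.
    have [i _ Fix] : (\bigcup_k F k) x by rewrite -FT.
    have [j _ Gjy] : (\bigcup_k G k) y by rewrite -GT.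
    exists (maxn i j) => //; split => /=.
      by move: Fix; exact/subsetPset/ndF/leq_maxl.
    by move: Gjy; exact/subsetPset/ndG/leq_maxr.
  move=> k; have [mF Fk] := Foo k; have [mG Gk] := Goo k; split.
    by rewrite -[X in measurable X]setTI; apply: mh => //; exact: measurableX.
  rewrite /pushforward -comp_preimage (_ : h \o f = id); last exact/funext.
  rewrite preimage_id /prod /= product_measure1E//.
  by rewrite lte_mul_pinfty// ge0_fin_numE.
exact: sigma_finite_measure_pack.
Qed.

Let leb0 n : @lebesgue_rV R n set0 = 0%E.
Proof. by have [mu ->] := lebesgue_rV_sigma_finite_measure n. Qed.

Let leb_ge0 n (A : set 'rV[R]_n) : (0 <= lebesgue_rV A)%E.
Proof. by have [mu ->] := lebesgue_rV_sigma_finite_measure n. Qed.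

Let leb_semi_sigma_additive n : semi_sigma_additive (@lebesgue_rV R n).
Proof.
have [mu ->] := lebesgue_rV_sigma_finite_measure n.
exact: measure_semi_sigma_additive.
Qed.

HB.instance Definition _ n := isMeasure.Build _ _ _ (@lebesgue_rV R n)
  (leb0 n) (@leb_ge0 n) (@leb_semi_sigma_additive n).

Let leb_sigma_finite n : sigma_finite setT (@lebesgue_rV R n).
Proof.
have [mu ->] := lebesgue_rV_sigma_finite_measure n.
exact: sigma_finiteT.
Qed.

HB.instance Definition _ n := Measure_isSigmaFinite.Build _ _ _
  (@lebesgue_rV R n) (leb_sigma_finite n).

Lemma lebesgue_rV_box (n : nat) (A : 'I_n -> set R) :
  (forall i, measurable (A i)) ->
  lebesgue_rV [set v : 'rV[R]_n | forall i, A i (v ord0 i)] =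
  (\prod_(i < n) lebesgue_measure (A i))%E.
Proof.
elim: n A => [|n IH] A mA.
  rewrite big_ord0 /= diracE (_ : _ \in _ = true)//.
  by apply/mem_set => -[].
rewrite big_ord_recl -IH; last by move=> i; exact: mA.
rewrite -product_measure1E; [|exact: mA|]; last first.
  rewrite [X in measurable X](_ : _ = \bigcap_(i in [set: 'I_n])
    ((fun v : 'rV[R]_n => v ord0 i) @^-1` (A (lift ord0 i)))).
    apply: fin_bigcap_measurable => // i _.
    rewrite -[X in measurable X]setTI.
    by apply: measurable_rV_coord => //; exact: mA.
  by apply/seteqP; split => v /= Av i; [move=> _|]; exact: Av.
rewrite /= /pushforward; congr (_ _).
have row0 (p : measurableTypeR R * 'rV[R]_n) :
    (row_mx p.1%:M p.2 : 'rV[R]_n.+1) ord0 ord0 = p.1.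
  rewrite (_ : ord0 = lshift n ord0 :> 'I_(1 + n)); last exact/val_inj.
  by apply: etrans (row_mxEl _ _ _ _) _; rewrite mxE eqxx mulr1n.
have rowS (p : measurableTypeR R * 'rV[R]_n) i :
    (row_mx p.1%:M p.2 : 'rV[R]_n.+1) ord0 (lift ord0 i) = p.2 ord0 i.
  rewrite (_ : lift ord0 i = rshift 1 i :> 'I_(1 + n)); last exact/val_inj.
  exact: row_mxEr.
apply/seteqP; split => [p Ap|p [Ap1 Ap2] i] /=.
  split => [|i] /=; first by have := Ap ord0; rewrite row0.
  by have := Ap (lift ord0 i); rewrite rowS.
by case: (fintype.unliftP ord0 i) => [j|] ->; rewrite ?row0 ?rowS.
Qed.

End lebesgue_rV_measure.
Arguments lebesgue_rV {R n}.

Section generative_model.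
Context {R : realType}.

Record generative_model (D N : nat) := GenerativeModel {
  generator : 'rV[R]_D -> 'rV[R]_N ;
  rate_param : R ;
  shape_param : R ;
  rate_param_gt0 : 0 < rate_param ;
  shape_param_gt0 : 0 < shape_param }.

Definition Gamma (s : R) : R :=
  \int[lebesgue_measure]_(t in `]0, +oo[) (t `^ (s - 1) * expR (- t)).

(* normal_pdf takes the mean and the standard deviation. *)
Definition gaussian_density (D : nat) (z : 'rV[R]_D) : R :=
  \prod_(i < D) normal_pdf 0 1 (z ord0 i).

(* p(z' | z), with z = z_{t-1} and z' = z_t *)
Definition transition_density (D : nat) (lambda alpha : R)
    (z z' : 'rV[R]_D) : R :=
  \prod_(i < D)
    (alpha * lambda `^ (1 / alpha) / (2 * Gamma (1 / alpha)) *
     expR (- lambda * `|z' ord0 i - z ord0 i| `^ alpha)).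

Definition latent_density (D : nat) (lambda alpha : R)
    (w : 'rV[R]_D * 'rV[R]_D) : R :=
  gaussian_density w.1 * transition_density lambda alpha w.1 w.2.

(* The probability that (z_{t-1}, z_t) falls in A. The integral of the library
   is a supremum over simple functions, so that this is the intended value as
   soon as A is measurable for the completion of the Lebesgue measure. *)
Definition latent_law (D : nat) (lambda alpha : R)
    (A : set ('rV[R]_D * 'rV[R]_D)) : \bar R :=
  (\int[lebesgue_rV \x lebesgue_rV]_(w in A)
    (latent_density lambda alpha w)%:E)%E.

(* The law of (x_{t-1}, x_t) = (g(z_{t-1}), g(z_t)). No Borel measurability of
   g is required: a function that is differentiable almost everywhere is
   continuous almost everywhere, so that the preimage of a Borel set is
   measurable for the completion of the Lebesgue measure. *)
Definition observation_law (D N : nat) (M : generative_model D N)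
    (B : set ('rV[R]_N * 'rV[R]_N)) : \bar R :=
  latent_law (rate_param M) (shape_param M)
    [set w | B (generator M w.1, generator M w.2)].

Definition signed_perm (D : nat) (pi : 'S_D) (s : 'I_D -> bool)
    (z : 'rV[R]_D) : 'rV[R]_D :=
  \row_i ((-1) ^+ s i * z ord0 (pi i)).

End generative_model.
Arguments generative_model R D N : clear implicits.

(* Main.v *)
(** Let [f] and [g] be the two generators. Restricted to a countable union of
    compact sets of full measure on which both are continuous, they have
    measurable images and preimages, so the equality of the laws of the
    observed pairs can be tested on rectangles [E * E'] pulled back by [f] and
    by [g]. Call [a] and [b] coupled if arbitrarily small neighbourhoods of [a]
    and [b] contain the [f]- and [g]-preimages of a common non-negligible set
    [E]. Shrinking [E] around [(a, b)] and [E'] around [(a', b')], the integrals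
    of the latent density [p] over the two pullbacks of a rectangle agree, so
    that [p (a, a') / p (b, b')] is nearly a product of the two unknown volume
    ratios of [E] and of [E']. These ratios cancel in
    [p (a, a') / p (a', a)] and in
    [p (a, a) p (a', a') / (p (a, a') p (a', a))], so that coupling preserves
    [sum_i |a_i - a'_i| ^ alpha] and, up to an additive constant, the Euclidean
    norm. No change of variables is needed, and only the positivity of the
    normalising constant matters.

    Every point is coupled to some point, hence the additive constant vanishes
    and coupling is the graph of a map [h] that preserves both quantities. Since
    [alpha < 2], the points of the axes are those for which the two quantities
    are related in an extremal way; thus [h] permutes the half-axes, and the
    distances of [z] to the points of a half-axis determine its coordinate
    there, so that [h] is a signed permutation. *)

Require Import Defs.
From mathcomp Require Import all_boot all_order all_algebra perm.
From mathcomp Require Import all_classical all_reals all_analysis.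
From mathcomp Require Import measurable_realfun ring lra.

Set Implicit Arguments.
Unset Strict Implicit.
Unset Printing Implicit Defensive.

Import Order.TTheory GRing.Theory Num.Theory.
Import numFieldNormedType.Exports.

Local Open Scope classical_set_scope.
Local Open Scope ring_scope.

(** * Cubes and Lebesgue measure on row vectors *)

Section cbox.
Context {R : realType}.

Definition cbox n (c : 'rV[R]_n) (r : R) : set 'rV[R]_n :=
  [set v | forall i, `|v ord0 i - c ord0 i| <= r].

Lemma cbox_center n (c : 'rV[R]_n) r : 0 <= r -> cbox c r c.
Proof. by move=> r0 i; rewrite subrr normr0. Qed.

Lemma cbox_subset n (c c' : 'rV[R]_n) r s :
  cbox c s c' -> cbox c' r `<=` cbox c (r + s).
Proof.
move=> cc' v vc' i; rewrite (le_trans (ler_distD (c' ord0 i) _ _))//.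
by rewrite lerD.
Qed.

Lemma cbox_le n (c : 'rV[R]_n) r s : r <= s -> cbox c r `<=` cbox c s.
Proof. by move=> rs v vc i; exact: le_trans (vc i) rs. Qed.

Lemma cbox_sym n (c c' : 'rV[R]_n) r : cbox c r c' -> cbox c' r c.
Proof. by move=> cc' i; rewrite distrC. Qed.

Lemma measurable_cbox n (c : 'rV[R]_n) r : measurable (cbox c r).
Proof.
rewrite [X in measurable X](_ : _ = \bigcap_(i in [set: 'I_n])
    ((fun v : 'rV[R]_n => v ord0 i) @^-1` `[c ord0 i - r, c ord0 i + r])).
  apply: fin_bigcap_measurable => // i _.
  by rewrite -[X in measurable X]setTI; exact: measurable_rV_coord.
apply/seteqP; split => v vc i; [move=> _|]; have := vc i.
  by rewrite /= in_itv/= ler_distl.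
by move=> /(_ I); rewrite /= in_itv/= ler_distl.
Qed.

Lemma ball_cbox n (c : 'rV[R]_n) r : ball c r `<=` cbox c r.
Proof.
by move=> v [r0 vc] i; have := vc ord0 i; rewrite /ball/= distrC => /ltW.
Qed.

Lemma cbox_ball n (c : 'rV[R]_n) r s : 0 < s -> r < s -> cbox c r `<=` ball c s.
Proof.
move=> s0 rs v vc; split => // i j; rewrite !ord1 /ball/= distrC.
exact: le_lt_trans (vc j) rs.
Qed.

Lemma nbhs_cboxP n (c : 'rV[R]_n) (A : set 'rV[R]_n) :
  nbhs c A <-> exists2 e, 0 < e & cbox c e `<=` A.
Proof.
split => [/nbhs_ballP[e /= e0 eA]|[e e0 eA]].
  exists (e / 2); rewrite ?divr_gt0//; apply: subset_trans eA.
  by apply: cbox_ball => //; rewrite ltr_pdivrMr// ltr_pMr// ltr1n.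
by apply/nbhs_ballP; exists e => //; apply: subset_trans eA; exact: ball_cbox.
Qed.

Lemma closed_cbox n (c : 'rV[R]_n) r : closed (cbox c r).
Proof.
move=> v vc i; rewrite leNgt; apply/negP => rv.
have [e e0 re] : exists2 e, 0 < e & r + e < `|v ord0 i - c ord0 i|.
  exists ((`|v ord0 i - c ord0 i| - r) / 2); first by rewrite divr_gt0// subr_gt0.
  lra.
have [|w [wc wv]] := vc (cbox v e); first by apply/nbhs_cboxP; exists e.
have := le_trans (ler_distD (w ord0 i) (v ord0 i) (c ord0 i))
  (lerD (eqbLR (congr1 (fun x => x <= e) (distrC _ _)) (wv i)) (wc i)).
by rewrite leNgt addrC re.
Qed.

Lemma compact_cbox n (c : 'rV[R]_n) r : compact (cbox c r).
Proof.
pose B := [set v : 'rV[R]_n | forall i, v ord0 i \in `[c ord0 i - r, c ord0 i + r]].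
rewrite (_ : cbox c r = B).
  apply: (@rV_compact _ _ (fun i => `[c ord0 i - r, c ord0 i + r]%classic)).
  by move=> i; exact: segment_compact.
by apply/seteqP; split => v vc i; have := vc i; rewrite in_itv/= ler_distl.
Qed.

(** These cubes form a countable base of the topology; they make open sets measurable and supply the
    cells of [coupled_ae]. *)
Lemma rational_cbox n (z : 'rV[R]_n) e : 0 < e -> exists p : 'rV[rat]_n * nat,
  let B := cbox (map_mx ratr p.1) (p.2.+1%:R^-1) in B z /\ B `<=` cbox z e.
Proof.
move=> e0.
have [k [k0 ke]] : exists k : nat, 0 < k.+1%:R^-1 :> R /\ k.+1%:R^-1 < e / 2.
  exists (Num.truncn (e / 2)^-1).
  split; first by rewrite invr_gt0 ltr0n.
  by rewrite invf_plt ?posrE ?divr_gt0 ?ltr0n// truncnS_gt.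
move: k0 ke; set r : R := k.+1%:R^-1 => r0 re.
have q_ i : exists q : rat, `|z ord0 i - ratr q| <= r.
  have /rat_in_itvoo[q] : z ord0 i - r < z ord0 i + r by lra.
  rewrite in_itv/= => /andP[q1 q2]; exists q.
  rewrite ler_distl; apply/andP; split; lra.
have [q qP] := choice q_.
exists (\row_i q i, k) => /=; split => [i|v vq i]; first by rewrite !mxE.
rewrite (le_trans (ler_distD (ratr (q i)) _ _))//.
have := vq i; have := qP i; rewrite !mxE -/r (distrC (z _ _)); lra.
Qed.

Lemma open_measurable_rV n (U : set 'rV[R]_n) : open U -> measurable U.
Proof.
move=> oU.
pose B (p : 'rV[rat]_n * nat) : set 'rV[R]_n :=
  cbox (map_mx ratr p.1) (p.2.+1%:R^-1).
rewrite (_ : U = \bigcup_p (if `[< B p `<=` U >] then B p else set0)).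
  apply: countable_bigcupT_measurable; first exact: countableP.
  by move=> p; case: ifP => // _; exact: measurable_cbox.
apply/seteqP; split => [z Uz|z [p _]]; last first.
  by case: ifPn => [/asboolP + Bz|_ []]; exact.
have /nbhs_cboxP[e e0 eU] := open_nbhs_nbhs (conj oU Uz).
have [p [Bz Be]] := rational_cbox z e0; exists p => //.
by case: ifPn => // /asboolP; case; exact: subset_trans Be eU.
Qed.

Lemma closed_measurable_rV n (A : set 'rV[R]_n) : closed A -> measurable A.
Proof.
by move=> cA; rewrite -(setCK A); apply: measurableC; apply: open_measurable_rV;
  rewrite openC.
Qed.

Lemma lebesgue_cbox n (c : 'rV[R]_n) r : 0 <= r ->
  lebesgue_rV (cbox c r) = ((r *+ 2) ^+ n)%:E.
Proof.
move=> r0.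
rewrite (_ : cbox c r =
    [set v | forall i, `[c ord0 i - r, c ord0 i + r]%classic (v ord0 i)]); last first.
  by apply/seteqP; split => v vc i; have := vc i; rewrite /= in_itv/= ler_distl.
rewrite (lebesgue_rV_box (A := fun i => `[c ord0 i - r, c ord0 i + r]%classic))//.
rewrite (eq_bigr (fun _ => (r *+ 2)%:E)).
  by rewrite prodEFin prodr_const card_ord.
move=> i _; rewrite lebesgue_measure_itv/= lte_fin.
case: ifPn => [_|]; first by rewrite -EFinD; congr EFin; ring.
rewrite -leNgt => H; congr EFin; move: H r0; lra.
Qed.

Lemma lebesgue_cbox_gt0 n (c : 'rV[R]_n) r : 0 < r ->
  (0 < lebesgue_rV (cbox c r))%E.
Proof. by move=> r0; rewrite lebesgue_cbox ?ltW// lte_fin exprn_gt0// pmulrn_lgt0. Qed.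

(** A cube has positive measure, so it does not fit into the exceptional null set. *)
Lemma ae_dense n (P : set 'rV[R]_n) : {ae lebesgue_rV, forall z, P z} ->
  forall z e, 0 < e -> exists2 z', P z' & cbox z e z'.
Proof.
move=> [A [mA A0 PA]] z e e0; apply: contrapT => nP.
have : (lebesgue_rV (cbox z e) <= lebesgue_rV A)%E.
  apply: le_measure; rewrite ?inE//; first exact: measurable_cbox.
  by move=> z' z'z; apply: PA => Pz'; apply: nP; exists z'.
by rewrite A0 leNgt lebesgue_cbox_gt0.
Qed.

(** The [j]-th set consists of the centres of balls of radius 1 / (j + 1) inside [O]; it is closed
    because lying in an open ball is an open condition on the centre. *)
Lemma open_bigcup_closed n (O : set 'rV[R]_n) : open O ->
  exists F : nat -> set 'rV[R]_n, [/\ forall j, closed (F j),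
    {homo F : i j / (i <= j)%N >-> i `<=` j} & \bigcup_j F j = O].
Proof.
move=> oO; exists (fun j => [set z | ball z j.+1%:R^-1 `<=` O]); split.
- move=> j z zF w zw.
  have [z' [z'F wz']] := zF _ (open_nbhs_nbhs (conj
    (ball_open w (j.+1%:R^-1 : R)) (ball_sym zw))).
  by apply: z'F; exact: ball_sym.
- move=> i j ij z zO w zw; apply: zO; apply: le_ball zw.
  by rewrite lef_pV2 ?posrE ?ltr0n// ler_nat.
- apply/seteqP; split => [z [j _]|z Oz].
    by apply; apply: ballxx; rewrite invr_gt0 ltr0n.
  have /nbhs_ballP[e /= e0 eO] := open_nbhs_nbhs (conj oO Oz).
  exists (Num.truncn e^-1) => //= w zw; apply: eO; apply: le_ball zw.
  by rewrite invf_ple ?posrE ?ltr0n// ltW// truncnS_gt.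
Qed.

(** Each [O k] contains a closed set missing at most e / 2 ^ (k + 1) of the cube; the intersection
    of these sets with the cube is compact, and the losses add up to [e]. *)
Lemma gdelta_compact_approx n (O : nat -> set 'rV[R]_n) (r e : R) :
  0 < e -> (forall k, open (O k)) -> (forall k, lebesgue_rV (~` O k) = 0%E) ->
  exists K : set 'rV[R]_n, [/\ compact K, forall k, K `<=` O k &
    (lebesgue_rV (cbox 0 r `\` K) <= e%:E)%E].
Proof.
move=> e0 oO O0.
have F_ k : exists F : set 'rV[R]_n, [/\ closed F, F `<=` O k &
    (lebesgue_rV (cbox 0 r `\` F) <= (e / (2 ^ k.+1)%:R)%:E)%E].
  have [F [cF ndF FO]] := open_bigcup_closed (oO k).
  have mF j : measurable (F j) by exact: closed_measurable_rV.
  have mB j : measurable (cbox 0 r `\` F j).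
    by apply: measurableD => //; exact: measurable_cbox.
  have mI : measurable (\bigcap_j (cbox 0 r `\` F j)) by exact: bigcapT_measurable.
  have B0 : (lebesgue_rV (cbox (0 : 'rV[R]_n) r `\` F 0%N) < +oo)%E.
    apply: (@le_lt_trans _ _ (lebesgue_rV (cbox (0 : 'rV[R]_n) `|r|))).
      apply: le_measure; rewrite ?inE//; first exact: measurable_cbox.
      by move=> z [/cbox_le + _]; apply; exact: ler_norm.
    by rewrite lebesgue_cbox// ltry.
  have I0 : lebesgue_rV (\bigcap_j (cbox 0 r `\` F j)) = 0%E.
    apply: (subset_measure0 mI _ _ (O0 k)).
      by apply: measurableC; exact: open_measurable_rV.
    by move=> z zI; rewrite -FO => -[j _ Fjz]; have [] := zI j I.
  have ndB : nonincreasing_seq (fun j => cbox (0 : 'rV[R]_n) r `\` F j).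
    by move=> i j ij; apply/subsetPset; apply: setDS; exact: ndF.
  have ek : (0 < (e / (2 ^ k.+1)%:R)%:E)%E.
    by rewrite lte_fin divr_gt0// ltr0n expn_gt0.
  (* Continuity from above: the remainders decrease to a null set, so some [F N] meets the bound. *)
  have := nonincreasing_cvg_mu B0 mB mI ndB.
  rewrite [X in _ --> X]I0 => /(_ _ (open_ereal_lt' ek)).
  move=> [N _ NF]; exists (F N); split => //.
    by rewrite -FO; exact: bigcup_sup.
  by apply: ltW; exact: (NF N (leqnn N)).
have [F FP] := choice F_; exists (cbox 0 r `&` \bigcap_k F k); split.
- apply: subclosed_compact (@compact_cbox n 0 r) _; last exact: subIsetl.
  apply: closedI; first exact: closed_cbox.
  by apply: closed_bigI => k _; case: (FP k).
- by move=> k z [_ /(_ k I)]; case: (FP k) => _ + _; exact.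
have mF k : measurable (F k) by apply: closed_measurable_rV; case: (FP k).
have mB k : measurable (cbox 0 r `\` F k).
  by apply: measurableD => //; exact: measurable_cbox.
apply: (@le_trans _ _ (\sum_(k <oo) lebesgue_rV (cbox 0 r `\` F k))%E).
  apply: measure_sigma_subadditive => //.
    apply: measurableD; first exact: measurable_cbox.
    by apply: measurableI; [exact: measurable_cbox|exact: bigcapT_measurable].
  move=> z [rz nz]; apply: contrapT => nF; apply: nz; split => // k _.
  by apply: contrapT => nFk; apply: nF; exists k.
apply: le_trans (epsilon_trick0 xpredT (ltW e0)).
by apply: lee_nneseries => // k _; case: (FP k).
Qed.

Let invr_gt0_nat k : 0 < k.+1%:R^-1 :> R.
Proof. by rewrite invr_gt0 ltr0n. Qed.

(** The index [(k, m)] stands for the cube of radius [k] and the precision 1 / (m + 1); what the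
    compact sets miss of one cube is bounded by every precision, hence null. *)
Lemma gdelta_sigma_compact n (O : nat -> set 'rV[R]_n) :
  (forall k, open (O k)) -> (forall k, lebesgue_rV (~` O k) = 0%E) ->
  exists K : nat * nat -> set 'rV[R]_n, [/\ forall k, compact (K k),
    forall k j, K k `<=` O j & lebesgue_rV (~` \bigcup_k K k) = 0%E].
Proof.
move=> oO O0.
have K_ (p : nat * nat) :=
  @gdelta_compact_approx n O p.1%:R p.2.+1%:R^-1 (invr_gt0_nat p.2) oO O0.
have [K KP] := choice K_; exists K; split => [p|p j|].
- by case: (KP p).
- by case: (KP p).
have mK p : measurable (K p).
  apply: closed_measurable_rV; apply: compact_closed; first exact: norm_hausdorff.
  by case: (KP p).
have mU : measurable (\bigcup_p K p).
  by apply: countable_bigcupT_measurable => //; exact: countableP.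
have mB k : measurable (cbox 0 k%:R `\` \bigcup_p K p).
  by apply: measurableD => //; exact: measurable_cbox.
apply/eqP; rewrite -measure_le0.
apply: (@le_trans _ _ (\sum_(k <oo) lebesgue_rV (cbox 0 k%:R `\` \bigcup_p K p))%E).
  apply: measure_sigma_subadditive => //; first exact: measurableC.
  move=> z zK; exists (Num.truncn (\sum_i `|z ord0 i|)).+1 => //; split => // i.
  rewrite mxE subr0 ltW// (le_lt_trans _ (truncnS_gt _))//.
  by rewrite (bigD1 i)//= lerDl sumr_ge0.
rewrite eseries0// => k _ _; apply/eqP; rewrite -measure_le0.
apply/lee_addgt0Pr => e e0; rewrite add0e.
pose m := Num.truncn e^-1.
apply: (@le_trans _ _ (lebesgue_rV (cbox 0 k%:R `\` K (k, m)))).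
  apply: le_measure; rewrite ?inE//.
    by apply: measurableD => //; exact: measurable_cbox.
  by apply: setDS; exact: bigcup_sup.
have [_ _ /le_trans] := KP (k, m); apply.
by rewrite lee_fin invf_ple ?posrE ?ltr0n// ltW// truncnS_gt.
Qed.

End cbox.

(** * Maps preserving the alpha-distance and the Euclidean norm *)

Section powR_scalar.
Context {R : realType}.
Variable a : R.
Hypothesis a0 : 0 < a.

Lemma ltr_powRl (x y : R) : 0 <= x -> x < y -> x `^ a < y `^ a.
Proof. by move=> x0 xy; rewrite gt0_ltr_powR// nnegrE// (le_trans x0)// ltW. Qed.

Lemma powRl_inj (x y : R) : 0 <= x -> 0 <= y -> x `^ a = y `^ a -> x = y.
Proof.
move=> x0 y0 xy; have [/ltr_powRl|/ltr_powRl|//] := ltrgtP x y.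
  by move=> /(_ x0); rewrite xy ltxx.
by move=> /(_ y0); rewrite xy ltxx.
Qed.

(** The two sides are the [a]-distances of points at heights [t] and [u] on one half-axis and on two
    different axes. *)
Lemma powR_dist_lt (t u : R) : 0 < t -> 0 < u -> `|t - u| `^ a < t `^ a + u `^ a.
Proof.
move=> t0 u0; have [tu|ut] := leP t u.
  apply: (@lt_trans _ _ (u `^ a)); last by rewrite ltrDr powR_gt0.
  by apply: ltr_powRl => //; rewrite distrC ger0_norm ?subr_ge0//; lra.
apply: (@lt_trans _ _ (t `^ a)); last by rewrite ltrDl powR_gt0.
by apply: ltr_powRl => //; rewrite ger0_norm ?subr_ge0 ?ltW//; lra.
Qed.

(* [t |-> |x - t| `^ a - |x| `^ a] has its minimum [- x `^ a] at [t = x]. *)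
Lemma powR_shift_inj (x y : R) : 0 < x ->
  (forall t, 0 < t -> `|y - t| `^ a - `|y| `^ a = `|x - t| `^ a - `|x| `^ a) ->
  y = x.
Proof.
move=> x0 xy; have := xy _ x0.
rewrite subrr normr0 powR0 ?gt_eqF// sub0r (gtr0_norm x0) => E.
have xa : 0 < x `^ a by exact: powR_gt0.
have [y0|] := ltP 0 y.
  have := xy _ y0; rewrite subrr normr0 powR0 ?gt_eqF// sub0r.
  rewrite (gtr0_norm y0) (gtr0_norm x0) => E'.
  move: E; rewrite (gtr0_norm y0) => E.
  have H1 := powR_ge0 `|y - x| a; have H2 := powR_ge0 `|x - y| a.
  have /(powRl_inj (normr_ge0 _)) : `|y - x| `^ a = 0 `^ a.
    by rewrite powR0 ?gt_eqF//; lra.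
  by move=> /(_ (lexx 0))/eqP; rewrite normr_eq0 subr_eq0 => /eqP.
move=> y0; have : `|y| `^ a < `|y - x| `^ a.
  by apply: ltr_powRl => //; rewrite !ler0_norm//; lra.
by lra.
Qed.

Lemma powR_sqr (x : R) : 0 <= x -> x ^+ 2 = x `^ a * x `^ (2 - a).
Proof.
rewrite le_eqVlt => /predU1P[<-|x0].
  by rewrite powR0 ?gt_eqF// mul0r expr0n.
rewrite -powRD; last by rewrite (gt_eqF x0) implybT.
by rewrite (_ : a + (2 - a) = 2%:R) ?powR_mulrn ?ltW//; ring.
Qed.

End powR_scalar.

Lemma signr_mul1_inj (R : realType) (x : R) (s r : bool) :
  (-1) ^+ s * x = 1 -> (-1) ^+ r * x = 1 -> s = r.
Proof. by case: s; case: r => //; rewrite expr0 expr1; lra. Qed.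

Lemma normr_subr1_neq (R : realType) (t : R) : 0 < t -> `|t - 1| <> t + 1.
Proof.
by move=> t0; have [?|?] := leP 0 (t - 1); [rewrite ger0_norm|rewrite ltr0_norm]
  => //; lra.
Qed.

Section isometry.
Context {R : realType} (D : nat).
Variable a : R.
Hypotheses (a0 : 0 < a) (a2 : a < 2).
Implicit Types (z w : 'rV[R]_D) (i j k : 'I_D) (b s : bool) (t : R).

Definition sqnorm z : R := \sum_i z ord0 i ^+ 2.

Definition powR_dist z w : R := \sum_i `|w ord0 i - z ord0 i| `^ a.

(** For [t > 0], [b] and [i] select one of the [2 D] half-axes, a negative one if [b] is true. *)
Definition axis_pt b i t : 'rV[R]_D :=
  \row_k (if k == i then (-1) ^+ b * t else 0).

Lemma powR_dist0 z : powR_dist 0 z = \sum_i `|z ord0 i| `^ a.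
Proof. by apply: eq_bigr => i _; rewrite mxE subr0. Qed.

Lemma normr_signl b (x : R) : `|(-1) ^+ b * x| = `|x|.
Proof. by rewrite normrM normrX normrN1 expr1n mul1r. Qed.

(** Compared with the distance from 0 only the [i]-th term changes, so the difference sees a single
    coordinate of [z]. *)
Lemma powR_dist_axis b i t z : powR_dist (axis_pt b i t) z =
  powR_dist 0 z - `|(-1) ^+ b * z ord0 i| `^ a + `|(-1) ^+ b * z ord0 i - t| `^ a.
Proof.
rewrite /powR_dist (bigD1 i)//= [in RHS](bigD1 i)//= !mxE eqxx subr0.
have <- : `|z ord0 i - (-1) ^+ b * t| = `|(-1) ^+ b * z ord0 i - t|.
  by rewrite -(normr_signl b) mulrBr mulrA -signr_addb addbb mul1r.
rewrite normr_signl.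
rewrite [X in _ + X](eq_bigr (fun k => `|z ord0 k| `^ a)); last first.
  by move=> k ki; rewrite !mxE (negbTE ki) subr0.
rewrite [X in _ + X - _ + _](eq_bigr (fun k => `|z ord0 k| `^ a)); last first.
  by move=> k ki; rewrite !mxE subr0.
ring.
Qed.

Lemma powR_dist0_axis b i t : 0 < t -> powR_dist 0 (axis_pt b i t) = t `^ a.
Proof.
move=> t0; rewrite powR_dist0 (bigD1 i)//= mxE eqxx normr_signl gtr0_norm//.
rewrite big1 ?addr0// => k ki.
by rewrite mxE (negbTE ki) normr0 powR0// gt_eqF.
Qed.

Lemma sqnorm_axis b i t : sqnorm (axis_pt b i t) = t ^+ 2.
Proof.
rewrite /sqnorm (bigD1 i)//= mxE eqxx exprMn sqrr_sign mul1r big1 ?addr0// => k ki.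
by rewrite mxE (negbTE ki) expr0n.
Qed.

(* the only place where [a < 2] matters: the equality case of
   [|x| ^ 2 <= t `^ (2 - a) * |x| `^ a] for [|x| <= t] *)
Lemma axis_ptP w t : 0 < t -> powR_dist 0 w = t `^ a -> sqnorm w = t ^+ 2 ->
  exists j s, w = axis_pt s j t.
Proof.
move=> t0; rewrite powR_dist0 => wa w2.
have wt i : `|w ord0 i| <= t.
  rewrite -(@ler_pXn2r _ 2)// ?nnegrE ?(ltW t0)// -w2 /sqnorm (bigD1 i)//=.
  by rewrite real_normK ?num_real// lerDl sumr_ge0// => k _; exact: sqr_ge0.
have ge0 i : 0 <= t `^ (2 - a) * `|w ord0 i| `^ a - w ord0 i ^+ 2.
  rewrite -[w ord0 i ^+ 2]real_normK ?num_real// (powR_sqr a0)// mulrC subr_ge0.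
  rewrite ler_wpM2l ?powR_ge0// ge0_ler_powR ?nnegrE ?subr_ge0 ?(ltW a2)//.
  exact: ltW.
(* This sum of nonnegative terms vanishes, so every coordinate is 0 or has absolute value [t]. *)
have : \sum_i (t `^ (2 - a) * `|w ord0 i| `^ a - w ord0 i ^+ 2) = 0.
  rewrite sumrB -mulr_sumr wa -/(sqnorm w) w2 (powR_sqr a0) ?ltW// mulrC subrr//.
move=> /(psumr_eq0P (fun i _ => ge0 i)) eq0.
have w0t i : w ord0 i = 0 \/ `|w ord0 i| = t.
  have := eq0 i isT; rewrite -[w ord0 i ^+ 2]real_normK ?num_real//.
  rewrite (powR_sqr a0)// mulrC -mulrBr => /eqP; rewrite mulf_eq0 powR_eq0.
  rewrite normr_eq0 => /orP[/andP[/eqP] |]; first by left.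
  rewrite subr_eq0 => /eqP/(@powRl_inj _ (2 - a)) tw; right; rewrite tw ?subr_gt0//.
  exact: ltW.
have [j wj] : exists j, `|w ord0 j| = t.
  apply: contrapT => nw; have : sqnorm w = 0.
    apply: big1 => i _; have [->|wi] := w0t i; first by rewrite expr0n.
    by exfalso; apply: nw; exists i.
  by rewrite w2 => /eqP; rewrite sqrf_eq0 gt_eqF.
exists j, (w ord0 j < 0); apply/rowP => k; rewrite mxE.
have [->|kj] := eqVneq k j.
  by rewrite -wj -realEsign ?num_real.
have [//|wk] := w0t k.
(* A second coordinate of size [t] would make the squared norm at least twice [t ^ 2]. *)
have := w2; rewrite /sqnorm (bigD1 j)//= (bigD1 k)//=.
rewrite -[w ord0 j ^+ 2]real_normK ?num_real// wj.
rewrite -[w ord0 k ^+ 2]real_normK ?num_real// wk.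
have : 0 <= \sum_(i < D | (i != j) && (i != k)) w ord0 i ^+ 2.
  by apply: sumr_ge0 => i _; exact: sqr_ge0.
have : 0 < t ^+ 2 by rewrite exprn_gt0.
by lra.
Qed.

Variable h : 'rV[R]_D -> 'rV[R]_D.
Hypothesis h_dist : forall z w, powR_dist (h z) (h w) = powR_dist z w.
Hypothesis h_norm : forall z, sqnorm (h z) = sqnorm z.

Lemma isometry0 : h 0 = 0.
Proof.
have : sqnorm (h 0) = 0 by rewrite h_norm; apply: big1 => i _; rewrite mxE expr0n.
move=> /(psumr_eq0P (fun i _ => sqr_ge0 _)) eq0; apply/rowP => i; rewrite mxE.
by apply/eqP; rewrite -sqrf_eq0 eq0.
Qed.

(** Subtracting the distance from [h 0 = 0] removes all coordinates but the one along the axis. *)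
Lemma isometry_axis_rel b i j s t z : h (axis_pt b i t) = axis_pt s j t ->
  `|(-1) ^+ s * h z ord0 j - t| `^ a - `|(-1) ^+ s * h z ord0 j| `^ a =
  `|(-1) ^+ b * z ord0 i - t| `^ a - `|(-1) ^+ b * z ord0 i| `^ a.
Proof.
move=> hE; have := h_dist (axis_pt b i t) z; rewrite hE !powR_dist_axis.
by have := h_dist 0 z; rewrite isometry0 => ->; lra.
Qed.

(** [axis_ptP] gives a half-axis for each [t]; comparison with the image at [t = 1] shows that it
    does not depend on [t]. *)
Lemma isometry_axis b i : exists (js : 'I_D * bool),
  forall t, 0 < t -> h (axis_pt b i t) = axis_pt js.2 js.1 t.
Proof.
have h_pt t : 0 < t -> exists j s, h (axis_pt b i t) = axis_pt s j t.
  move=> t0; apply: axis_ptP => //; last by rewrite h_norm sqnorm_axis.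
  by rewrite -isometry0 h_dist powR_dist0_axis.
have [j [s h1]] := h_pt 1 ltr01; exists (j, s) => t t0.
have [k [r ht]] := h_pt t t0; rewrite ht /=.
have := isometry_axis_rel (axis_pt b i t) h1.
rewrite ht !mxE eqxx mulrA -signr_addb addbb mul1r.
have [->|jk] := eqVneq j k; last first.
  (* Different axes would force |t - 1| ^ a = t ^ a + 1. *)
  rewrite /= mulr0 sub0r normrN normr1 normr0 powR1 (powR0 (lt0r_neq0 a0)) subr0.
  rewrite (gtr0_norm t0) => /esym/eqP; rewrite subr_eq => /eqP E.
  by have := powR_dist_lt a0 t0 ltr01; rewrite powR1 E addrC ltxx.
have [->//|sr] := eqVneq s r.
(* Opposite half-axes would force |t - 1| = t + 1. *)
rewrite mulrA -signr_addb (_ : s (+) r = true); last by move: (s) (r) sr => [] [].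
rewrite expr1 mulN1r normrN => /(@addIr _ _ _ _)/(powRl_inj a0 (normr_ge0 _)).
rewrite -opprD normrN => /(_ (normr_ge0 _)) E; exfalso.
by apply: (normr_subr1_neq t0); rewrite -E gtr0_norm ?addr_gt0.
Qed.

(** The half-axis onto which [h] carries the half-axis [(b, i)], with the index first and the sign
    second. *)
Let J b i := projT1 (cid (isometry_axis b i)).
Let JE b i t : 0 < t -> h (axis_pt b i t) = axis_pt (J b i).2 (J b i).1 t.
Proof. by move=> t0; rewrite /J; case: cid => /= js; apply. Qed.

(** By [powR_shift_inj], the distances to the points of a half-axis determine a positive coordinate
    along it; the relation is symmetric, so positivity on either side suffices. *)
Let coordP b i z :
  (0 < (-1) ^+ b * z ord0 i \/ 0 < (-1) ^+ (J b i).2 * h z ord0 (J b i).1) ->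
  (-1) ^+ (J b i).2 * h z ord0 (J b i).1 = (-1) ^+ b * z ord0 i.
Proof.
case=> [z0|hz0]; [|apply/esym]; apply: (powR_shift_inj a0) => // t t0.
  exact: isometry_axis_rel (JE _ _ t0).
exact/esym/(isometry_axis_rel _ (JE _ _ t0)).
Qed.

Let J1_inj : injective (fun i => (J false i).1).
Proof.
move=> i k /= Jik; apply/eqP; apply: contrapT => /negP ik.
have ki : k == i = false by rewrite eq_sym; exact/negbTE.
(* If the two image axes coincide, [z] shows that the signs agree; then [axis_pt false k 1] would
   have [i]-th coordinate 1 instead of 0. *)
pose z : 'rV[R]_D := axis_pt false i 1 + axis_pt false k 1.
have zi : (-1) ^+ false * z ord0 i = 1.
  by rewrite !mxE eqxx (negbTE ik) expr0 !mul1r addr0.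
have zk : (-1) ^+ false * z ord0 k = 1.
  by rewrite !mxE eqxx ki expr0 !mul1r add0r.
have := @coordP false i z; rewrite zi => /(_ (or_introl ltr01)).
have := @coordP false k z; rewrite zk => /(_ (or_introl ltr01)).
rewrite Jik => Ek Ei.
have ss : (J false i).2 = (J false k).2.
  exact: signr_mul1_inj Ei Ek.
have := @coordP false i (axis_pt false k 1); rewrite (JE _ _ ltr01) Jik ss !mxE.
rewrite eqxx mulrA -signr_addb addbb !mul1r (negbTE ik) => /(_ (or_intror ltr01)).
by move/eqP; rewrite oner_eq0.
Qed.

(** The injective index map is onto, so the image shares its axis with that of a positive half-axis
    [m]. Equal signs would give the unit point of a negative half-axis an [m]-th coordinate 1; [m]
    different from [i] would give one image point coordinate 1 along two opposite half-axes. *)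
Let J_true i : J true i = ((J false i).1, ~~ (J false i).2).
Proof.
have [m Em] : exists m, (J true i).1 = (J false m).1.
  by have [g _ gK] := injF_bij J1_inj; exists (g (J true i).1); rewrite gK.
have Es : (J true i).2 = ~~ (J false m).2.
  apply/eqP; apply: contrapT => /negP ss.
  have {}ss : (J true i).2 = (J false m).2.
    by move: ss; case: (J true i).2; case: (J false m).2.
  have := @coordP false m (axis_pt true i 1); rewrite (JE _ _ ltr01) Em ss !mxE.
  rewrite eqxx mulrA -signr_addb addbb !mul1r => /(_ (or_intror ltr01)).
  case: eqP => _; rewrite ?mulN1r => /eqP; last by rewrite oner_eq0.
    by rewrite gt_eqF// (lt_trans (ltrN10 _) ltr01).
suff mi : m = i by move: Em Es; rewrite mi; case: (J true i) => /= ? ? -> ->.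
apply/eqP; apply: contrapT => /negP mi.
have im : i == m = false by rewrite eq_sym; exact/negbTE.
pose z : 'rV[R]_D := axis_pt false m 1 + axis_pt true i 1.
have zi : (-1) ^+ true * z ord0 i = 1.
  by rewrite !mxE eqxx im expr1; ring.
have zm : (-1) ^+ false * z ord0 m = 1.
  by rewrite !mxE eqxx (negbTE mi) expr0; ring.
have := @coordP true i z; rewrite zi => /(_ (or_introl ltr01)).
have := @coordP false m z; rewrite zm => /(_ (or_introl ltr01)).
by rewrite Em Es => E1 E2; have := signr_mul1_inj E1 E2; case: (J false m).2.
Qed.

Let coordE i z : (-1) ^+ (J false i).2 * h z ord0 (J false i).1 = z ord0 i.
Proof.
have := @coordP true i z; rewrite J_true /= signrN.
have := @coordP false i z; rewrite expr0 expr1 mul1r.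
set x := z ord0 i; rewrite !mulNr mul1r !oppr_gt0.
set y := _ * h z _ _ => H1 H2.
have [x0|x0|x0] := ltrgtP x 0.
- by apply: oppr_inj; apply: H2; left.
- by apply: H1; left.
(* Here the coordinate of [z] is 0, and a nonzero [y] triggers the second alternative of
   [coordP]. *)
- have [y0|y0|//] := ltrgtP y 0; last by rewrite x0.
  + by apply: oppr_inj; apply: H2; right.
  + by apply: H1; right.
Qed.

Lemma isometry_signed_perm :
  exists (pi : 'S_D) (s : 'I_D -> bool), forall z, h z = signed_perm pi s z.
Proof.
pose p := perm J1_inj.
(* [J] sends coordinates of [z] to coordinates of [h z], whereas [signed_perm] looks them up in the
   other direction; hence the inverse. *)
exists (p^-1)%g, (fun k => (J false ((p^-1)%g k)).2) => z.
apply/rowP => k; rewrite mxE.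
rewrite -(coordE ((p^-1)%g k) z) mulrA -signr_addb addbb mul1r.
by have := permKV p k; rewrite {1}permE => ->.
Qed.

End isometry.

(** * The latent density *)

Section Gamma.
Context {R : realType}.
Local Notation mu := (@lebesgue_measure R).

(** The intervals [1 / (n + 2), 1] exhaust ]0, 1], and on each of them the primitive t ^ s / s
    bounds the integral by 1 / s. *)
Lemma integral_powR_lty (s : R) : 0 < s ->
  (\int[mu]_(t in `]0%R, 1%R]) (t `^ (s - 1))%:E < +oo)%E.
Proof.
move=> s0; pose F n : set R := `[n.+2%:R^-1, 1]%classic.
have Fn n : 0 < n.+2%:R^-1 :> R /\ n.+2%:R^-1 < 1 :> R.
  by rewrite invr_gt0 ltr0n invf_lt1 ?ltr1n ?ltr0n.
have FU : \bigcup_n F n = `]0, 1]%classic.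
  apply/seteqP; split => [t [n _]|t]; rewrite /F /= !in_itv/=.
    by move=> /andP[nt ->]; rewrite (lt_le_trans _ nt)//; case: (Fn n).
  move=> /andP[t0 t1]; exists (Num.truncn t^-1) => //=; rewrite in_itv/= t1 andbT.
  rewrite invf_ple ?posrE ?ltr0n// (le_trans (ltW (truncnS_gt _)))//.
  by rewrite ler_nat.
have mp : measurable_fun setT (EFin \o (fun t : R => t `^ (s - 1))).
  by apply/measurable_EFinP; exact: measurable_powR.
have : (\int[mu]_(t in F n) (t `^ (s - 1))%:E @[n --> \oo] -->
    \int[mu]_(t in \bigcup_n F n) (t `^ (s - 1))%:E)%E.
  apply: ge0_nondecreasing_set_cvg_integral => //.
  - move=> m n mn; apply/subsetPset => t; rewrite /F /= !in_itv/= => /andP[mt ->].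
    by rewrite (le_trans _ mt)// lef_pV2 ?posrE ?ltr0n// ler_nat.
  - by move=> n; rewrite /F; exact: measurable_itv.
  - by move=> n; apply: measurable_funS mp.
  - by move=> n x _; rewrite lee_fin powR_ge0.
rewrite FU => H; apply: (@le_lt_trans _ _ (s^-1)%:E); last exact: ltry.
apply: (cvge_to_le H); apply: nearW => n; have [n0 n1] := Fn n.
have dp (p x : R) : 0 < x -> {for x, continuous (@powR R ^~ p)}.
  move=> x0; apply/differentiable_continuous; rewrite -derivable1_diffP.
  by apply: derivable_powR; rewrite in_itv/= x0.
have dG (x : R) : 0 < x -> derivable (fun y : R => s^-1 * y `^ s) x 1.
  by move=> x0; apply: derivableM => //; apply: derivable_powR; rewrite in_itv/= x0.
have cG (x : R) : 0 < x -> {for x, continuous (fun y : R => s^-1 * y `^ s)}.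
  by move=> /dG x0; apply/differentiable_continuous; rewrite -derivable1_diffP.
rewrite (@continuous_FTC2 _ (fun t => t `^ (s - 1)) (fun t => s^-1 * t `^ s))//.
- rewrite powR1 mulr1 -EFinB lee_fin gerBl mulr_ge0 ?powR_ge0//.
  by rewrite invr_ge0 ltW.
- apply: continuous_in_subspaceT => x; rewrite inE/= in_itv/= => /andP[nx _].
  exact/dp/(lt_le_trans n0 nx).
- split.
  + move=> x; rewrite in_itv/= => /andP[nx _]; exact/dG/(lt_trans n0 nx).
  + exact/cvg_at_right_filter/cG.
  + exact/cvg_at_left_filter/cG.
- move=> x; rewrite in_itv/= => /andP[nx _]; have x0 := lt_trans n0 nx.
  rewrite derive1Ml; last by apply: derivable_powR; rewrite in_itv/= x0.
  by rewrite powR_derive1 ?in_itv/= ?x0// mulrA mulVf ?mul1r// gt_eqF.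
Qed.

(** [Rintegral] sends an infinite integral to 0, so positivity takes a finite upper bound as well as
    a positive lower one. *)
Lemma Gamma_gt0 (s : R) : 0 < s -> 0 < Gamma s.
Proof.
move=> s0; pose f (t : R) := t `^ (s - 1) * expR (- t).
have f0 t : 0 <= f t by rewrite mulr_ge0 ?powR_ge0 ?expR_ge0.
have mf : measurable_fun setT (EFin \o f).
  apply/measurable_EFinP; apply: measurable_funM; first exact: measurable_powR.
  by apply: measurableT_comp => //; exact: oppr_measurable.
have mfA (A : set R) : measurable_fun A (EFin \o f).
  exact: measurable_funS mf.
rewrite /Gamma /Rintegral; apply: fine_gt0; apply/andP; split.
  (* On [1, 2], t ^ (s - 1) >= 1 / t >= 1 / 2 since [s > 0], and exp (- t) >= exp (- 2). *)
  pose c : R := 2^-1 * expR (- 2).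
  have c0 : 0 < c by rewrite mulr_gt0 ?expR_gt0// invr_gt0.
  apply: (@lt_le_trans _ _ (\int[mu]_(t in `[1%R, 2%R]) c%:E)%E).
    rewrite integral_cst//= lebesgue_measure_itv/= lte_fin ltr1n.
    by rewrite -EFinB -EFinM lte_fin mulr_gt0//; lra.
  apply: (@le_trans _ _ (\int[mu]_(t in `[1%R, 2%R]) (f t)%:E)%E).
    apply: ge0_le_integral => //.
    - by move=> x _; rewrite lee_fin ltW.
    - exact: mfA.
    move=> t; rewrite /= in_itv/= => /andP[t1 t2]; rewrite lee_fin.
    apply: ler_pM; rewrite ?expR_ge0 ?invr_ge0//; last by rewrite ler_expR lerN2.
    apply: (@le_trans _ _ (t `^ (-1))); last by apply: ler_powR => //; lra.
    by rewrite powR_inv1 ?lef_pV2 ?posrE//; lra.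
  apply: ge0_subset_integral => //.
  - exact: mfA.
  - by move=> x _; rewrite lee_fin.
  - by move=> t; rewrite /= !in_itv/= andbT => /andP[t1 _]; lra.
have U : `]0, +oo[%classic = `]0, 1]%classic `|` `]1, +oo[%classic :> set R.
  apply/seteqP; split => t; rewrite /= !in_itv/= !andbT.
    by move=> ->; have [] := leP t 1; [left|right].
  by case=> [/andP[]//|/(lt_trans ltr01)].
rewrite U ge0_integral_setU//=; first last.
- apply/eqP/seteqP; split => // t; rewrite /= !in_itv/= andbT => -[/andP[_ t1] t1'].
  by move: (lt_le_trans t1' t1); rewrite ltxx.
- by move=> x _; rewrite lee_fin; exact: f0.
- exact: mfA.
apply: lte_add_pinfty.
  apply: le_lt_trans (integral_powR_lty s0); apply: ge0_le_integral => //.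
  - by move=> x _; rewrite lee_fin; exact: f0.
  - exact: mfA.
  - by apply/measurable_EFinP; apply: measurable_funS (@measurable_powR R _).
  move=> t; rewrite /= in_itv/= => /andP[t0 _]; rewrite lee_fin.
  by rewrite ler_piMr ?powR_ge0// -expR0 ler_expR oppr_le0 ltW.
pose n := (Num.truncn (s - 1)).+1.
(* From (t / 2) ^ n / n! <= exp (t / 2) follows t ^ n exp (- t) <= C exp (- t / 2), which is 2 C
   times the exponential density of rate 1 / 2. *)
pose C : R := n`!%:R * 2 ^+ n.
apply: (@le_lt_trans _ _
    (\int[mu]_t ((C * 2)%:E * (exponential_pdf 2^-1 t)%:E))%E); last first.
  rewrite ge0_integralZl//.
  - by rewrite integral_exponential_pdf ?invr_gt0// mule1 ltry.
  - by apply/measurable_EFinP; exact: measurable_exponential_pdf.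
  - by move=> x _; rewrite lee_fin exponential_pdf_ge0.
  - by rewrite lee_fin !mulr_ge0 ?exprn_ge0.
apply: (@le_trans _ _
    (\int[mu]_(t in `]1%R, +oo[) ((C * 2)%:E * (exponential_pdf 2^-1 t)%:E))%E); last first.
  apply: ge0_subset_integral => //.
  - apply: measurable_funeM; apply/measurable_EFinP.
    exact: measurable_exponential_pdf.
  - by move=> x _; rewrite -EFinM lee_fin !mulr_ge0 ?exprn_ge0 ?exponential_pdf_ge0.
apply: ge0_le_integral => //.
- by move=> x _; rewrite lee_fin; exact: f0.
- exact: mfA.
- apply: measurable_funeM; apply/measurable_EFinP.
  by apply: measurable_funS (measurable_exponential_pdf _).
move=> t; rewrite /= in_itv/= andbT => t1; rewrite -EFinM lee_fin.
have t0 : 0 < t by rewrite (lt_trans _ t1).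
rewrite (exponential_pdfE _ (ltW t0)) mulrA mulfK ?pnatr_eq0//.
rewrite (_ : - t = t / 2 * (- 1) + - 2^-1 * t); last by field.
rewrite /f expRD mulrA ler_pM2r ?expR_gt0// mulrN1 expRN ler_pdivrMr ?expR_gt0//.
apply: (@le_trans _ _ (t ^+ n)).
  rewrite -powR_mulrn ?(ltW t0)// ler_powR ?(ltW t1)// /n ltW//; exact: truncnS_gt.
have := @expR_ge1Dxn _ (t / 2) n.-1 (divr_ge0 (ltW t0) (ler0n _ _)).
rewrite /= -/n => H; have {}H : (t / 2) ^+ n / n`!%:R <= expR (t / 2).
  by apply: le_trans H; rewrite lerDr.
rewrite (_ : t ^+ n = (t / 2) ^+ n / n`!%:R * C); last first.
  rewrite /C mulrA mulfVK ?pnatr_eq0 -?lt0n ?fact_gt0// -exprMn mulfVK//.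
by rewrite mulrC ler_wpM2l// mulr_ge0 ?exprn_ge0.
Qed.

End Gamma.

Lemma continuous_powR_norm (R : realType) (a : R) : 0 < a ->
  continuous (fun x : R => `|x| `^ a).
Proof.
move=> a0 x; have [->|x0] := eqVneq x 0; last first.
  have nx0 : 0 < `|x| by rewrite normr_gt0.
  have cp : {for `|x|, continuous (@powR R ^~ a)}.
    apply/differentiable_continuous; rewrite -derivable1_diffP.
    by apply: derivable_powR; rewrite in_itv/= nx0.
  exact: (@continuous_comp _ _ _ (@Num.norm R R) (@powR R ^~ a) x
    (@norm_continuous _ R x) cp).
rewrite /continuous_at normr0 powR0 ?gt_eqF//; apply/cvgr0Pnorm_lt => e e0.
near=> y; rewrite ger0_norm ?powR_ge0//.
have -> : e = (e `^ a^-1) `^ a by rewrite -powRrM mulVf ?gt_eqF// powRr1// ltW.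
apply: ltr_powRl => //; near: y.
exists (e `^ a^-1) => /=; first exact: powR_gt0.
by move=> y /=; rewrite sub0r normrN.
Unshelve. all: by end_near. Qed.

Section latent_density.
Context {R : realType} (D : nat).
Variables (lambda alpha : R).
Hypotheses (lambda0 : 0 < lambda) (alpha0 : 0 < alpha).
Implicit Types w : 'rV[R]_D * 'rV[R]_D.

(** The normalising constant is left out. *)
Definition log_density w : R :=
  - (sqnorm w.1 / 2) - lambda * powR_dist alpha w.1 w.2.

Lemma latent_densityE : exists2 c : R, 0 < c &
  forall w, latent_density lambda alpha w = c * expR (log_density w).
Proof.
have prod_expR (c : R) (u : 'I_D -> R) :
    \prod_(i < D) (c * expR (u i)) = c ^+ D * expR (\sum_i u i).
  by rewrite big_split/= prodr_const card_ord expR_sum.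
exists (normal_peak 1 ^+ D *
    (alpha * lambda `^ (1 / alpha) / (2 * Gamma (1 / alpha))) ^+ D).
  apply: mulr_gt0; apply: exprn_gt0; first by rewrite normal_peak_gt0 ?oner_eq0.
  by rewrite divr_gt0// mulr_gt0 ?powR_gt0 ?Gamma_gt0 ?divr_gt0.
move=> w; rewrite /latent_density /gaussian_density /transition_density.
rewrite prod_expR normal_pdfE ?oner_eq0// prod_expR mulrACA -expRD.
congr (_ * expR (_ + _)); last first.
  by rewrite /powR_dist mulr_sumr -sumrN; apply: eq_bigr => i _; rewrite mulNr.
rewrite /sqnorm mulr_suml -sumrN; apply: eq_bigr => i _.
by rewrite subr0 expr1n mulNr.
Qed.

Lemma measurable_log_density : measurable_fun setT log_density.
Proof.
have m1 i : measurable_fun setT (fun w => w.1 ord0 i).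
  exact: (measurableT_comp (measurable_rV_coord i) measurable_fst).
have m2 i : measurable_fun setT (fun w => w.2 ord0 i).
  exact: (measurableT_comp (measurable_rV_coord i) measurable_snd).
apply: measurable_funB.
  apply: measurableT_comp => //; apply: measurable_funM => //.
  by apply: measurable_sum => i; exact: measurable_funX.
apply: measurable_funM => //; apply: measurable_sum => i.
apply: (@measurableT_comp _ _ _ _ _ _ (@powR R ^~ alpha)).
  exact: measurable_powR.
by apply: measurableT_comp => //; exact: measurable_funB.
Qed.

Lemma continuous_log_density : continuous log_density.
Proof.
have c1 i : continuous (fun w => w.1 ord0 i).
  move=> w; exact: (@continuous_comp _ _ _ fst (fun v : 'rV[R]_D => v ord0 i) w cvg_fst
    (@coord_continuous R _ _ ord0 i w.1)).
have c2 i : continuous (fun w => w.2 ord0 i).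
  move=> w; exact: (@continuous_comp _ _ _ snd (fun v : 'rV[R]_D => v ord0 i) w cvg_snd
    (@coord_continuous R _ _ ord0 i w.2)).
have csum (F : 'I_D -> 'rV[R]_D * 'rV[R]_D -> R) : (forall i, continuous (F i)) ->
    continuous (fun w => \sum_i F i w).
  by move=> cF; apply: continuous_big => //; exact: add_continuous.
move=> w; apply: cvgB.
  apply: cvgN; apply: cvgMr_tmp; apply: csum => i {}w.
  by apply: cvgM; exact: c1.
apply: cvgMl_tmp; apply: csum => i {}w.
apply: (@continuous_comp _ _ _ (fun w => w.2 ord0 i - w.1 ord0 i)
  (fun x : R => `|x| `^ alpha)).
  by apply: cvgB; [exact: c2|exact: c1].
exact: continuous_powR_norm.
Qed.

End latent_density.

(** * Integrals of the latent density *)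

Section integral_subset.
Import HBNNSimple.

(** The integral is a supremum over the simple functions below [f], so monotonicity extends to sets
    not known to be measurable, such as preimages under a generator. *)
Lemma ge0_integral_subset d (T : measurableType d) (R : realType)
    (mu : {measure set T -> \bar R}) (A B : set T) (f : T -> \bar R) :
  (forall x, 0 <= f x)%E -> A `<=` B ->
  (\int[mu]_(x in A) f x <= \int[mu]_(x in B) f x)%E.
Proof.
move=> f0 AB; rewrite integral_mkcond [leRHS]integral_mkcond.
rewrite !ge0_integralTE; [|by move=> x; exact: erestrict_ge0..].
apply: ereal_sup_le => _ [h /= hf <-].
exists h => // x; apply: le_trans (hf x) _; rewrite /patch.
case: ifPn => [xA|_]; last by case: ifPn.
by rewrite ifT// inE; apply: AB; rewrite -inE.
Qed.

End integral_subset.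

Lemma near_log_density (R : realType) D (lambda alpha : R) (a a' : 'rV[R]_D) e :
  0 < alpha -> 0 < e -> exists2 r, 0 < r & forall z z', cbox a r z -> cbox a' r z' ->
    `|log_density lambda alpha (z, z') - log_density lambda alpha (a, a')| <= e.
Proof.
move=> alpha0 e0.
have /cvgrPdist_le/(_ _ e0)/nbhs_ballP[r /= r0 rL] :=
  @continuous_log_density R D lambda alpha alpha0 (a, a').
exists (r / 2) => [|z z' az az']; first by rewrite divr_gt0.
have r2 : r / 2 < r by lra.
rewrite distrC; apply: rL; split => /=; exact: cbox_ball az || exact: cbox_ball az'.
Qed.

Section latent_density_integral.
Context {R : realType} (D : nat) (lambda alpha : R).
Hypotheses (lambda0 : 0 < lambda) (alpha0 : 0 < alpha).
Local Notation leb := (@lebesgue_rV R D).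
Local Notation leb2 := (@lebesgue_rV R D \x @lebesgue_rV R D)%E.
Local Notation dens := (@latent_density R D lambda alpha).
Local Notation L := (@log_density R D lambda alpha).

Lemma latent_density_gt0 w : 0 < dens w.
Proof.
have [c c0 ->] := @latent_densityE R D lambda alpha lambda0 alpha0.
by rewrite mulr_gt0// expR_gt0.
Qed.

Lemma measurable_latent_density (A : set ('rV[R]_D * 'rV[R]_D)) :
  measurable_fun A (EFin \o dens).
Proof.
have [c c0 dE] := @latent_densityE R D lambda alpha lambda0 alpha0.
apply: measurable_funTS; apply/measurable_EFinP.
rewrite (_ : dens = fun w => c * expR (L w)); last exact/funext.
apply: measurable_funM => //; apply: measurableT_comp => //.
exact: measurable_log_density.
Qed.

(** The density is positive, so the law vanishes exactly when the product measure, the square of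
    that of [X], does. This carries null sets from one generator to the other. *)
Lemma latent_law_null (X : set 'rV[R]_D) : measurable X ->
  latent_law lambda alpha (X `*` X) = 0%E <-> leb X = 0%E.
Proof.
move=> mX; have mXX : measurable (X `*` X) by exact: measurableX.
have -> : latent_law lambda alpha (X `*` X) =
    (\int[leb2]_(w in X `*` X) `|(EFin \o dens) w|)%E.
  by apply: eq_integral => w _; rewrite gee0_abs//= lee_fin ltW// latent_density_gt0.
have XXE : leb2 (X `*` X) = (leb X * leb X)%E by exact: product_measure1E.
split=> [|X0]; last first.
  apply: integral_abs_eq0 => //; first exact: measurable_latent_density.
  by apply: etrans XXE _; rewrite X0 mule0.
move=> /(ae_eq_integral_abs _ mXX (@measurable_latent_density _))[A [mA A0 XA]].
have : leb2 (X `*` X) = 0%E.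
  apply: (subset_measure0 mXX mA _ A0) => w Xw; apply: XA => /(_ Xw)/= [].
  by apply/eqP; rewrite gt_eqF// latent_density_gt0.
by rewrite XXE => /eqP; rewrite mule_eq0 orbb => /eqP.
Qed.

(** On the rectangle the density lies between c exp (l - e) and c exp (l + e); integrating and
    taking logarithms separates the two volumes, with [k = ln c]. *)
Lemma ln_latent_law_rect : exists k : R,
  forall (X Y : set 'rV[R]_D) (l e : R), measurable X -> measurable Y ->
  (0 < leb X < +oo)%E -> (0 < leb Y < +oo)%E ->
  (forall z z', X z -> Y z' -> `|L (z, z') - l| <= e) ->
  `|ln (fine (latent_law lambda alpha (X `*` Y)))
    - (k + l + ln (fine (leb X)) + ln (fine (leb Y)))| <= e.
Proof.
have [c c0 dE] := @latent_densityE R D lambda alpha lambda0 alpha0.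
exists (ln c) => X Y l e mX mY /andP[X0 Xoo] /andP[Y0 Yoo] Le.
have mXY : measurable (X `*` Y) by exact: measurableX.
have XYE : leb2 (X `*` Y) = (leb X * leb Y)%E by exact: product_measure1E.
have [x [x0 xE]] : exists x, 0 < x /\ leb X = x%:E.
  by exists (fine (leb X)); rewrite fineK ?ge0_fin_numE//; split => //;
    apply: fine_gt0; rewrite X0.
have [y [y0 yE]] : exists y, 0 < y /\ leb Y = y%:E.
  by exists (fine (leb Y)); rewrite fineK ?ge0_fin_numE//; split => //;
    apply: fine_gt0; rewrite Y0.
have {}XYE : leb2 (X `*` Y) = (x * y)%:E by rewrite XYE xE yE.
rewrite xE yE /=.
have cstE (d : R) : (\int[leb2]_(w in X `*` Y) d%:E = (d * (x * y))%:E)%E.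
  by rewrite integral_cst// EFinM; congr (_ * _)%E; exact: XYE.
have lo : ((c * expR (l - e) * (x * y))%:E <= latent_law lambda alpha (X `*` Y))%E.
  apply: (@le_trans _ _ (\int[leb2]_(w in X `*` Y) (c * expR (l - e))%:E)%E).
    by rewrite cstE.
  apply: ge0_le_integral => //.
  - by move=> w _; rewrite lee_fin mulr_ge0 ?expR_ge0// ltW.
  - exact: measurable_latent_density.
  - move=> [z z'] [/= Xz Yz']; rewrite lee_fin dE ler_wpM2l ?(ltW c0)// ler_expR.
    by have := Le _ _ Xz Yz'; rewrite ler_distl => /andP[].
have hi : (latent_law lambda alpha (X `*` Y) <= (c * expR (l + e) * (x * y))%:E)%E.
  apply: (@le_trans _ _ (\int[leb2]_(w in X `*` Y) (c * expR (l + e))%:E)%E).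
    apply: ge0_le_integral => //.
    - by move=> w _; rewrite lee_fin ltW// latent_density_gt0.
    - exact: measurable_latent_density.
    - move=> [z z'] [/= Xz Yz']; rewrite lee_fin dE ler_wpM2l ?(ltW c0)// ler_expR.
      by have := Le _ _ Xz Yz'; rewrite ler_distl => /andP[].
  by rewrite cstE.
move: lo hi; case: (latent_law _ _ _) => [I| |]//; rewrite !lee_fin /= => lo hi.
have lnE (d : R) : ln (c * expR d * (x * y)) = ln c + d + (ln x + ln y).
  by rewrite !lnM ?posrE ?mulr_gt0 ?expR_gt0// expRK.
have p0 d : 0 < c * expR d * (x * y) by rewrite !mulr_gt0 ?expR_gt0.
have I0 : 0 < I by exact: lt_le_trans (p0 _) lo.
have := lo; rewrite -ler_ln ?posrE// lnE => lo'.
have := hi; rewrite -ler_ln ?posrE// lnE => hi'.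
by rewrite ler_distl; lra.
Qed.

End latent_density_integral.

(** * Coupling of the latents of two generators *)

Section coupling.
Context {R : realType} (D N : nat).
Implicit Types f g : 'rV[R]_D -> 'rV[R]_N.

(** Measurability of the preimage is demanded because [f] is an arbitrary map. *)
Definition localizes f (a : 'rV[R]_D) (e : R) (E : set 'rV[R]_N) :=
  [/\ measurable (f @^-1` E), f @^-1` E `<=` cbox a e
    & (0 < lebesgue_rV (f @^-1` E))%E].

Definition coupled_by f g a b e E :=
  [/\ measurable E, localizes f a e E & localizes g b e E].

(* the closed support of the joint law of the two latents of one observation *)
Definition coupled f g (a b : 'rV[R]_D) :=
  forall e, 0 < e -> exists E, coupled_by f g a b e E.

Lemma localizes_le f a b r e E : cbox b e a -> localizes f a r E ->
  localizes f b (r + e) E.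
Proof. by move=> ab [mf fE f0]; split => //; exact: subset_trans fE (cbox_subset ab). Qed.

Lemma coupled_by_le f g a b r e E : r <= e ->
  coupled_by f g a b r E -> coupled_by f g a b e E.
Proof.
move=> re [mE [mf fE f0] [mg gE g0]]; split => //; split => //.
- exact: subset_trans fE (cbox_le re).
- exact: subset_trans gE (cbox_le re).
Qed.

Lemma coupledC f g a b : coupled f g a b -> coupled g f b a.
Proof.
move=> ab e e0; have [E []] := ab e e0; by exists E.
Qed.

(** A set localized within [e / 2] at a nearby coupled pair is localized within [e] at [(a, b)]. *)
Lemma coupled_closed f g a b :
  (forall e, 0 < e -> exists a' b', [/\ coupled f g a' b', cbox a e a' & cbox b e b']) ->
  coupled f g a b.
Proof.
move=> ab e e0; have e2 : 0 < e / 2 by rewrite divr_gt0.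
have [a' [b' [ab' aa' bb']]] := ab _ e2.
have [E [mE fE gE]] := ab' _ e2; exists E.
by rewrite [e]splitr; split => //; [exact: localizes_le fE|exact: localizes_le gE].
Qed.

Lemma lebesgue_sub_cbox (c : 'rV[R]_D) r (A : set 'rV[R]_D) : 0 <= r ->
  measurable A -> A `<=` cbox c r -> (lebesgue_rV A < +oo)%E.
Proof.
move=> r0 mA Ac; apply: (@le_lt_trans _ _ (lebesgue_rV (cbox c r))).
  by apply: le_measure; rewrite ?inE//; exact: measurable_cbox.
by rewrite lebesgue_cbox// ltry.
Qed.

Lemma preimage_setI_image f g (F G : set 'rV[R]_D) : injective f ->
  f @^-1` (f @` F `&` g @` G) = F `&` f @^-1` (g @` G).
Proof.
move=> f_inj; apply/seteqP; split => z /= [].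
  by move=> [z' Fz' /f_inj <-].
by move=> Fz gz; split => //; exists z.
Qed.

Lemma closed_setI_preimage f (F : set 'rV[R]_D) (A : set 'rV[R]_N) :
  closed F -> (forall z, F z -> {for z, continuous f}) -> closed A ->
  closed (F `&` f @^-1` A).
Proof.
move=> cF fc cA z zFA; have Fz : F z.
  by apply: cF => B /zFA[z' [[Fz' _] Bz']]; exists z'.
split => //; apply: cA => B /(fc _ Fz)/zFA[z' [[_ Az'] Bz']].
by exists (f z').
Qed.

Lemma compact_image_rV f (F : set 'rV[R]_D) : compact F ->
  (forall z, F z -> {for z, continuous f}) -> compact (f @` F).
Proof.
move=> cF fc; apply: continuous_compact => //.
apply: continuous_in_subspaceT => z; rewrite inE; exact: fc.
Qed.

End coupling.

(** * Density relations between coupled pairs *)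

Section equal_laws.
Context {R : realType} (D N : nat) (lambda alpha : R).
Hypotheses (lambda0 : 0 < lambda) (alpha0 : 0 < alpha).
Local Notation leb := (@lebesgue_rV R D).
Local Notation L := (@log_density R D lambda alpha).
Variables f g : 'rV[R]_D -> 'rV[R]_N.
Hypothesis law_eq : forall B : set ('rV[R]_N * 'rV[R]_N), measurable B ->
  latent_law lambda alpha [set w | B (f w.1, f w.2)] =
  latent_law lambda alpha [set w | B (g w.1, g w.2)].

Lemma law_eq_rect (E E' : set 'rV[R]_N) : measurable E -> measurable E' ->
  latent_law lambda alpha (f @^-1` E `*` f @^-1` E') =
  latent_law lambda alpha (g @^-1` E `*` g @^-1` E').
Proof. by move=> mE mE'; exact: law_eq (measurableX mE mE'). Qed.

(** The logarithm of the volume ratio of the two pullbacks of [E]. *)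
Let t E := ln (fine (leb (g @^-1` E))) - ln (fine (leb (f @^-1` E))).

(** Both pullbacks of the rectangle have the same mass; [ln_latent_law_rect] estimates its logarithm
    on each side with error [e / 2], and the constant [k] cancels. *)
Lemma coupled_log_density a b a' b' e : 0 < e ->
  exists2 r, 0 < r & forall E E', coupled_by f g a b r E ->
    coupled_by f g a' b' r E' ->
  `|L (a, a') - L (b, b') - t E - t E'| <= e.
Proof.
move=> e0; have e2 : 0 < e / 2 by rewrite divr_gt0.
have [r1 r10 aL] := near_log_density lambda a a' alpha0 e2.
have [r2 r20 bL] := near_log_density lambda b b' alpha0 e2.
have [k kP] := @ln_latent_law_rect R D lambda alpha lambda0 alpha0.
have r0 : 0 < Num.min r1 r2 by rewrite lt_min r10.
exists (Num.min r1 r2) => // E E' [mE [mf fE f0] [mg gE g0]].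
move=> [mE' [mf' fE' f0'] [mg' gE' g0']].
have fin c A : measurable A -> (0 < leb A)%E -> A `<=` cbox c (Num.min r1 r2) ->
    (0 < leb A < +oo)%E.
  by move=> mA A0 Ac; rewrite A0 (lebesgue_sub_cbox _ mA Ac)// ltW.
have rf := kP _ _ (L (a, a')) (e / 2) mf mf' (fin _ _ mf f0 fE) (fin _ _ mf' f0' fE').
have rg := kP _ _ (L (b, b')) (e / 2) mg mg' (fin _ _ mg g0 gE) (fin _ _ mg' g0' gE').
have {rf} := rf _; have {rg} := rg _.
rewrite (law_eq_rect mE mE') /t !ler_distl => Hg Hf.
have /Hf/andP[] : forall z z', (f @^-1` E) z -> (f @^-1` E') z' ->
    `|L (z, z') - L (a, a')| <= e / 2.
  move=> z z' /fE zE /fE' zE'; apply: aL.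
    by apply: cbox_le zE; rewrite ge_min lexx.
  by apply: cbox_le zE'; rewrite ge_min lexx.
have /Hg/andP[] : forall z z', (g @^-1` E) z -> (g @^-1` E') z' ->
    `|L (z, z') - L (b, b')| <= e / 2.
  move=> z z' /gE zE /gE' zE'; apply: bL.
    by apply: cbox_le zE; rewrite ge_min lexx orbT.
  by apply: cbox_le zE'; rewrite ge_min lexx orbT.
clear; lra.
Qed.

(** Each value of [M] is nearly a sum of two numbers, one for each of its pairs, and for exact sums
    both identities are trivial. *)
Lemma coupled_log_density_cocycle a b a' b' : coupled f g a b -> coupled f g a' b' ->
  let M z w z' w' := L (z, z') - L (w, w') in
  M a b a' b' = M a' b' a b /\ M a b a' b' + M a b a' b' = M a b a b + M a' b' a' b'.
Proof.
move=> ab ab' M.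
have H e : 0 < e -> exists s s', [/\ `|M a b a' b' - s - s'| <= e,
    `|M a' b' a b - s' - s| <= e, `|M a b a b - s - s| <= e &
    `|M a' b' a' b' - s' - s'| <= e].
  move=> e0.
  have [r1 r10 H1] := coupled_log_density a b a' b' e0.
  have [r2 r20 H2] := coupled_log_density a' b' a b e0.
  have [r3 r30 H3] := coupled_log_density a b a b e0.
  have [r4 r40 H4] := coupled_log_density a' b' a' b' e0.
  (* One radius for the four estimates, so that the same [E] and [E'] serve in all of them. *)
  pose r := Num.min (Num.min r1 r2) (Num.min r3 r4).
  have r0 : 0 < r by rewrite !lt_min r10 r20 r30.
  have [E EP] := ab _ r0; have [E' EP'] := ab' _ r0.
  exists (t E), (t E').
  by split; [apply: H1|apply: H2|apply: H3|apply: H4]; apply: coupled_by_le EP ||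
    apply: coupled_by_le EP'; rewrite !ge_min lexx ?orbT.
move: (M a b a' b') (M a' b' a b) (M a b a b) (M a' b' a' b') H => x y p q H.
split; apply/eqP; rewrite -subr_eq0 -normr_le0; apply/ler_addgt0Pr => e e0;
  (* The second identity accumulates four errors. *)
  rewrite add0r; have e4 : 0 < e / 4 by rewrite divr_gt0.
- have [s [s' []]] := H _ e4; rewrite !ler_norml.
  by lra.
- have [s [s' []]] := H _ e4; rewrite !ler_norml.
  by lra.
Qed.

(** Exchanging the two points cancels the symmetric distances and leaves the norms; the diagonal
    terms contain no distance, so the second identity then isolates the distances. *)
Lemma coupled_isometry a b a' b' : coupled f g a b -> coupled f g a' b' ->
  powR_dist alpha a a' = powR_dist alpha b b' /\
  sqnorm b - sqnorm a = sqnorm b' - sqnorm a'.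
Proof.
move=> ab ab'.
have dist0 (z : 'rV[R]_D) : powR_dist alpha z z = 0.
  by apply: big1 => i _; rewrite subrr normr0 powR0// gt_eqF.
have distC (z w : 'rV[R]_D) : powR_dist alpha z w = powR_dist alpha w z.
  by apply: eq_bigr => i _; rewrite distrC.
have [] := coupled_log_density_cocycle ab ab'; rewrite /log_density /= !dist0.
rewrite (distC a' a) (distC b' b).
move: (sqnorm a) (sqnorm b) (sqnorm a') (sqnorm b') => x y x' y'.
move: (powR_dist alpha a a') (powR_dist alpha b b') => p q.
move=> H1 H2; have E : y - x = y' - x' by lra.
split=> //; apply: (mulfI (lt0r_neq0 lambda0)).
by lra.
Qed.

End equal_laws.

(** * Compact sets on which both generators are continuous *)

Lemma negligible_bigcup_countType d (T : measurableType d) (R : realType)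
    (mu : {measure set T -> \bar R}) (I : countType) (F : I -> set T) :
  (forall i, mu.-negligible (F i)) -> mu.-negligible (\bigcup_i F i).
Proof.
move=> F0; pose G k := if unpickle k is Some i then F i else set0.
have G0 k : mu.-negligible (G k).
  by rewrite /G; case: (unpickle k) => [i|]; [exact: F0|exact: negligible_set0].
apply: negligibleS (negligible_bigcup G0) => z [i _ Fiz].
by exists (pickle i) => //; rewrite /G pickleK.
Qed.

(** Intersected over [e = 1 / (k + 1)], these sets give the continuity points, which thus form a
    G-delta set. *)
Lemma oscillation_open (R : realType) D N (f : 'rV[R]_D -> 'rV[R]_N) (e : R) :
  open [set z | exists2 r, 0 < r & forall x y, cbox z r x -> cbox z r y ->
    cbox (f x) e (f y)].
Proof.
rewrite openE => z [r r0 zr]; apply/nbhs_cboxP.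
have r2 : 0 < r / 2 by rewrite divr_gt0.
exists (r / 2) => // z' zz'; exists (r / 2) => // x y xz' yz'.
by apply: zr; rewrite [r]splitr; exact: cbox_subset xz' || exact: cbox_subset yz'.
Qed.

Lemma continuous_cboxP (R : realType) D N (f : 'rV[R]_D -> 'rV[R]_N) z :
  {for z, continuous f} <->
  forall e, 0 < e -> exists2 r, 0 < r & forall x, cbox z r x -> cbox (f z) e (f x).
Proof.
split => [fz e e0|H A].
  by have /nbhs_cboxP := fz (cbox (f z) e) (proj2 (nbhs_cboxP _ _)
    (ex_intro2 _ _ e e0 (@subset_refl _ _))).
move=> /nbhs_cboxP[e e0 eA]; have [r r0 rz] := H e e0.
by apply/nbhs_cboxP; exists r => // x /rz/eA.
Qed.

Lemma ae_continuous_compacts (R : realType) D N (f g : 'rV[R]_D -> 'rV[R]_N) :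
  {ae lebesgue_rV, forall z, {for z, continuous f}} ->
  {ae lebesgue_rV, forall z, {for z, continuous g}} ->
  exists K : nat * nat -> set 'rV[R]_D, [/\ forall k, compact (K k),
    forall k z, K k z -> {for z, continuous f} /\ {for z, continuous g}
    & lebesgue_rV (~` \bigcup_k K k) = 0%E].
Proof.
move=> fc gc.
pose O (h : 'rV[R]_D -> 'rV[R]_N) (e : R) := [set z | exists2 r, 0 < r &
  forall x y, cbox z r x -> cbox z r y -> cbox (h x) e (h y)].
have cO h z e : 0 < e -> {for z, continuous h} -> O h e z.
  move=> e0 /continuous_cboxP hz; have [|r r0 rz] := hz (e / 2).
    by rewrite divr_gt0.
  exists r => // x y /rz xz /rz yz; rewrite [e]splitr.
  exact: cbox_subset (cbox_sym xz) _ yz.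
have Oc h z : (forall k : nat, O h k.+1%:R^-1 z) -> {for z, continuous h}.
  move=> Oz; apply/continuous_cboxP => e e0.
  have [r r0 rz] := Oz (Num.truncn e^-1); exists r => // x zx.
  apply: cbox_le (rz z x _ zx); last exact/cbox_center/ltW.
  by rewrite invf_ple ?posrE ?ltr0n// ltW// truncnS_gt.
pose U k := O f k.+1%:R^-1 `&` O g k.+1%:R^-1.
have oU k : open (U k) by apply: openI; exact: oscillation_open.
have e0 (k : nat) : 0 < k.+1%:R^-1 :> R by rewrite invr_gt0 ltr0n.
have U0 k : lebesgue_rV (~` U k) = 0%E.
  apply/negligibleP; first by apply: measurableC; exact: open_measurable_rV.
  apply: negligibleS (negligibleU fc gc) => z /=; apply: contra_notP.
  move=> /not_orP[/contrapT fz /contrapT gz].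
  by split; exact: cO.
have [K [cK KU K0]] := gdelta_sigma_compact oU U0; exists K; split => // k z Kz.
by split; apply: Oc => j; have [] := KU k j z Kz.
Qed.

(** * Every point is coupled *)

Section equal_laws_ae.
Context {R : realType} (D N : nat) (lambda alpha : R).
Hypotheses (lambda0 : 0 < lambda) (alpha0 : 0 < alpha).
Local Notation leb := (@lebesgue_rV R D).
Variables f g : 'rV[R]_D -> 'rV[R]_N.
Hypotheses (f_inj : injective f) (g_inj : injective g).
Hypothesis fc : {ae leb, forall z, {for z, continuous f}}.
Hypothesis gc : {ae leb, forall z, {for z, continuous g}}.
Hypothesis law_eq : forall B : set ('rV[R]_N * 'rV[R]_N), measurable B ->
  latent_law lambda alpha [set w | B (f w.1, f w.2)] =
  latent_law lambda alpha [set w | B (g w.1, g w.2)].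

(** Three null sets are discarded: the complement of the compact sets, the points of these sets
    whose value under [f] is not taken there by [g], and the countably many pullbacks [f @^-1] of
    cells that are null. Any other point has a partner, and the cells around the two have non-null
    pullbacks. *)
Lemma coupled_ae : {ae leb, forall z, exists2 w, f z = g w & coupled f g z w}.
Proof.
have [K [cK Kc K0]] := ae_continuous_compacts fc gc.
have hD : hausdorff_space 'rV[R]_D by exact: norm_hausdorff.
have hN : hausdorff_space 'rV[R]_N by exact: norm_hausdorff.
have clK k : closed (K k) by exact: compact_closed.
have Kf k z : K k z -> {for z, continuous f} by move=> /Kc[].
have Kg k z : K k z -> {for z, continuous g} by move=> /Kc[].
have mK : measurable (\bigcup_k K k).
  apply: countable_bigcupT_measurable; first exact: countableP.
  by move=> k; exact: closed_measurable_rV.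
pose W := \bigcup_k (g @` K k).
have clg k : closed (g @` K k).
  by apply: compact_closed => //; apply: compact_image_rV => // z /Kg.
have mW : measurable W.
  apply: countable_bigcupT_measurable; first exact: countableP.
  by move=> k; exact: closed_measurable_rV.
(* The points of the compact sets with value outside [W], written in terms of closed sets so as to
   be visibly measurable. *)
pose Z := \bigcup_k K k `\` \bigcup_(p : (nat * nat) * (nat * nat))
  (K p.1 `&` f @^-1` (g @` K p.2)).
have mZ : measurable Z.
  apply: measurableD => //; apply: countable_bigcupT_measurable.
    exact: countableP.
  move=> p; apply: closed_measurable_rV; apply: closed_setI_preimage => //.
  by move=> z /Kf.
have Z0 : leb Z = 0%E.
  apply/(latent_law_null lambda0 alpha0 mZ)/eqP; rewrite eq_le; apply/andP; split.
    (* Under [g] the complement of [W] pulls back to the null complement of the compact sets; under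
       [f] its pullback contains [Z]. *)
    have := law_eq (measurableX (measurableC mW) (measurableC mW)).
    rewrite (_ : [set w | (_ `*` _) (g w.1, g w.2)] =
        (~` \bigcup_k K k) `*` (~` \bigcup_k K k)); last first.
      apply/seteqP; split => -[z z'] /=.
        by move=> [nz nz']; split => -[k _ Kz]; [apply: nz|apply: nz']; exists k => //;
          exact: imageP.
      by move=> [nz nz']; split => -[k _ [w Kw /g_inj wz]]; [apply: nz|apply: nz'];
        exists k => //; rewrite -wz.
    rewrite (proj2 (latent_law_null lambda0 alpha0 (measurableC mK)) K0) => <-.
    apply: ge0_integral_subset.
      by move=> w; rewrite lee_fin ltW// latent_density_gt0.
    have ZW z : Z z -> ~ W (f z).
      by move=> [[k _ Kz] nz] [j _ gz]; apply: nz; exists (k, j).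
    by move=> [z z'] /= [/ZW ? /ZW ?].
  by apply: integral_ge0 => w _; rewrite lee_fin ltW// latent_density_gt0.
pose B (p : 'rV[rat]_D * nat) := cbox (map_mx ratr p.1 : 'rV[R]_D) p.2.+1%:R^-1.
pose I := ((nat * nat) * (nat * nat) * (('rV[rat]_D * nat) * ('rV[rat]_D * nat)))%type.
(* A cell pairs a compact piece for [f] with one for [g], both cut by rational cubes and so
   arbitrarily small. *)
pose F (i : I) := K i.1.1 `&` B i.2.1.
pose G (i : I) := K i.1.2 `&` B i.2.2.
have cF i : compact (F i).
  by apply: compact_closedI => //; exact: closed_cbox.
have cG i : compact (G i).
  by apply: compact_closedI => //; exact: closed_cbox.
have Ff i z : F i z -> {for z, continuous f} by move=> [/Kf].
have Gg i z : G i z -> {for z, continuous g} by move=> [/Kg].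
have cfF i : closed (f @` F i).
  by apply: compact_closed => //; apply: compact_image_rV => // z /Ff.
have cgG i : closed (g @` G i).
  by apply: compact_closed => //; apply: compact_image_rV => // z /Gg.
pose E i := f @` F i `&` g @` G i.
have fE i : f @^-1` E i = F i `&` f @^-1` (g @` G i) by exact: preimage_setI_image.
have gE i : g @^-1` E i = G i `&` g @^-1` (f @` F i).
  by rewrite /E setIC; exact: preimage_setI_image.
have mfE i : measurable (f @^-1` E i).
  rewrite fE; apply: closed_measurable_rV; apply: closed_setI_preimage => //.
    exact: compact_closed.
  by move=> z /Ff.
have mgE i : measurable (g @^-1` E i).
  rewrite gE; apply: closed_measurable_rV; apply: closed_setI_preimage => //.
    exact: compact_closed.
  by move=> z /Gg.
pose A i := if leb (f @^-1` E i) == 0%E then f @^-1` E i else set0.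
have A0 i : leb.-negligible (A i).
  rewrite /A; case: ifPn => [/eqP E0|_]; last exact: negligible_set0.
  exact/negligibleP.
have bad : leb.-negligible ((Z `|` ~` (\bigcup_k K k)) `|` \bigcup_i A i).
  apply: negligibleU; last exact: (@negligible_bigcup_countType _ _ _ _ I A A0).
  apply: negligibleU; first exact/negligibleP.
  by apply/negligibleP => //; exact: measurableC.
apply: negligibleS bad => z nz; apply: contrapT => /not_orP[/not_orP[nZ /contrapT Cz] nA].
apply: nz; have [w fzw [j Kw]] : exists2 w, f z = g w & exists j, K j w.
  apply: contrapT => nw; apply: nZ; split => // -[[k j] _ [/= Kz [w Kw gw]]].
  by apply: nw; exists w => //; exists j.
exists w => // e e0; case: Cz => k _ Kz.
have [p [pz pe]] := rational_cbox z e0; have [q [qw qe]] := rational_cbox w e0.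
pose i : I := ((k, j), (p, q)).
have fEz : (f @^-1` E i) z.
  by rewrite fE; split => //=; exists w.
have fE0 : leb (f @^-1` E i) != 0%E.
  apply/negP => E0; apply: nA; exists i => //.
  by rewrite /A E0.
have mE : measurable (E i).
  by apply: closed_measurable_rV; apply: closedI.
exists (E i); split => //; split => //.
- by rewrite fE => x [[_ /pe]].
- by rewrite lt0e fE0/=.
- by rewrite gE => x [[_ /qe]].
(* Were the pullback by [g] null, the square of [E i] would have mass 0 under both laws, and the
   pullback by [f] would be null too. *)
- rewrite lt0e measure_ge0 andbT; apply: contraNN fE0 => /eqP gE0; apply/eqP.
  apply/(latent_law_null lambda0 alpha0 (mfE i)).
  rewrite (law_eq_rect law_eq mE mE).
  exact/(latent_law_null lambda0 alpha0 (mgE i)).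
Qed.

(** Coupled points [u n] converge to [a]. Their partners stay bounded, because coupling changes the
    squared norm by a constant; so they have a cluster point, and [coupled_closed] applies. *)
Lemma coupled_total a : exists b, coupled f g a b.
Proof.
have near_a e : 0 < e -> exists a' b', coupled f g a' b' /\ cbox a e a'.
  move=> e0; have [a' [b' _ ab'] aa'] := ae_dense coupled_ae a e0.
  by exists a', b'.
have e0 (n : nat) : 0 < n.+1%:R^-1 :> R by rewrite invr_gt0 ltr0n.
have [u uP] := choice (fun n => near_a _ (e0 n)).
have [v vP] := choice uP.
(* Bounds the squared norms of the [v n]: the sum bounds those of the [u n], and the constant
   difference is read off at 0. *)
pose r := \sum_i (`|a ord0 i| + 1) ^+ 2 + sqnorm (v 0%N) - sqnorm (u 0%N).
have vr n : cbox 0 (r + 1) (v n).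
  have [uv au] := vP n; have [uv0 _] := vP 0%N.
  have [_] := coupled_isometry lambda0 alpha0 law_eq uv uv0 => vn.
  have un : sqnorm (u n) <= \sum_i (`|a ord0 i| + 1) ^+ 2.
    apply: ler_sum => i _; rewrite -[leLHS]real_normK ?num_real//.
    rewrite ler_pXn2r ?nnegrE ?addr_ge0//.
    have -> : u n ord0 i = (u n ord0 i - a ord0 i) + a ord0 i by rewrite subrK.
    rewrite addrC (le_trans (ler_normD _ _))// lerD2l (le_trans (au i))//.
    by rewrite invf_le1 ?ltr0n// ler1n.
  have vnr : sqnorm (v n) <= r by rewrite /r; clear uv uv0 vP uP near_a; lra.
  have r0 : 0 <= r by apply: le_trans vnr; apply: sumr_ge0 => i _; exact: sqr_ge0.
  have r1 : 0 <= r + 1 := addr_ge0 r0 ler01.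
  move=> i; rewrite mxE subr0 -(@ler_pXn2r _ 2)// ?nnegrE.
  rewrite real_normK ?num_real//; apply: (@le_trans _ _ r).
    apply: le_trans vnr; rewrite /sqnorm (bigD1 i)//= lerDl.
    by apply: sumr_ge0 => k _; exact: sqr_ge0.
  by rewrite -subr_ge0; have := sqr_ge0 r; rewrite !expr2; nra.
have [|b [_ bP]] := @compact_cbox R D 0 (r + 1) (v @ \oo) _.
  by exists 0%N => // n _; exact: vr.
exists b; apply: coupled_closed => e ep.
have [n ne] : exists n : nat, n.+1%:R^-1 <= e.
  by exists (Num.truncn e^-1); rewrite invf_ple ?posrE ?ltr0n// ltW// truncnS_gt.
have [_ [[m nm <-] bv]] : v @` [set m | (n <= m)%N] `&` cbox b e !=set0.
  apply: bP; first by exists n => // m nm; exists m.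
  by apply/nbhs_cboxP; exists e.
have [uv au] := vP m; exists (u m), (v m); split => //.
apply: cbox_le au; apply: le_trans ne.
by rewrite lef_pV2 ?posrE ?ltr0n// ler_nat.
Qed.

End equal_laws_ae.

(** * From coupling to a signed permutation *)

Lemma powR_dist_eq0 (R : realType) D (a : R) (z w : 'rV[R]_D) : 0 < a ->
  powR_dist a z w = 0 -> w = z.
Proof.
move=> a0 /(psumr_eq0P (fun i _ => powR_ge0 _ _)) zw; apply/rowP => i.
by have /eqP := zw i isT; rewrite powR_eq0 normr_eq0 subr_eq0 => /andP[/eqP].
Qed.

Lemma coupled_signed_perm (R : realType) D N (lambda alpha : R)
    (f g : 'rV[R]_D -> 'rV[R]_N) :
  0 < lambda -> 0 < alpha -> alpha < 2 -> injective f -> injective g ->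
  {ae lebesgue_rV, forall z, {for z, continuous f}} ->
  {ae lebesgue_rV, forall z, {for z, continuous g}} ->
  (forall B : set ('rV[R]_N * 'rV[R]_N), measurable B ->
    latent_law lambda alpha [set w | B (f w.1, f w.2)] =
    latent_law lambda alpha [set w | B (g w.1, g w.2)]) ->
  exists (pi : 'S_D) (s : 'I_D -> bool),
    {ae lebesgue_rV, forall z : 'rV[R]_D, f z = g (signed_perm pi s z)}.
Proof.
move=> lambda0 alpha0 alpha2 f_inj g_inj fc gc law_eq.
have ctot a := coupled_total lambda0 alpha0 f_inj g_inj fc gc law_eq a.
have [h hP] := choice ctot.
have isom := coupled_isometry lambda0 alpha0 law_eq.
have hnorm z : sqnorm (h z) = sqnorm z.
  have law_eq' B (mB : measurable B) := esym (law_eq B mB).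
  (* The constant is nonnegative because 0 has a partner, and nonpositive because, by symmetry, 0 is
     the partner of some [b]. *)
  have [b /coupledC b0] := coupled_total lambda0 alpha0 g_inj f_inj gc fc law_eq' 0.
  have [_] := isom _ _ _ _ (hP z) b0; have [_] := isom _ _ _ _ (hP 0) b0.
  have -> : sqnorm (0 : 'rV[R]_D) = 0 by apply: big1 => i _; rewrite mxE expr0n.
  have sq0 (x : 'rV[R]_D) : 0 <= sqnorm x by apply: sumr_ge0 => i _; exact: sqr_ge0.
  have := sq0 b; have := sq0 (h 0).
  move: (sqnorm _) (sqnorm _) (sqnorm _) (sqnorm _) => x y p q.
  by clear; lra.
have hdist z w : powR_dist alpha (h z) (h w) = powR_dist alpha z w.
  by have [] := isom _ _ _ _ (hP z) (hP w).
have [pi [s hE]] := isometry_signed_perm alpha0 alpha2 hdist hnorm.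
exists pi, s; apply: filterS (coupled_ae lambda0 alpha0 f_inj g_inj fc gc law_eq).
move=> z [w -> zw]; rewrite -hE; congr g.
(* Both [h z] and [w] are coupled to [z], so their distance equals that of [z] to itself. *)
apply: (powR_dist_eq0 alpha0); have [<- _] := isom _ _ _ _ (hP z) zw.
by apply: big1 => i _; rewrite subrr normr0 powR0// gt_eqF.
Qed.

Lemma signed_perm_cbox (R : realType) D (pi : 'S_D) (s : 'I_D -> bool)
    (z w : 'rV[R]_D) r :
  cbox z r w -> cbox (signed_perm pi s z) r (signed_perm pi s w).
Proof.
by move=> zw i; rewrite !mxE -mulrBr normrM normrX normrN1 expr1n mul1r.
Qed.

(** The set of equality is dense by [ae_dense], so equality passes to the limit where both sides are
    continuous. *)
Lemma ae_eq_continuity_pt (R : realType) D N (f g : 'rV[R]_D -> 'rV[R]_N)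
    (pi : 'S_D) (s : 'I_D -> bool) :
  {ae lebesgue_rV, forall z, f z = g (signed_perm pi s z)} ->
  forall z, {for z, continuous f} -> {for signed_perm pi s z, continuous g} ->
  f z = g (signed_perm pi s z).
Proof.
move=> fg z /continuous_cboxP fz /continuous_cboxP gz; apply/rowP => i.
apply/eqP; rewrite -subr_eq0 -normr_le0; apply/ler_addgt0Pr => e e0; rewrite add0r.
have e2 : 0 < e / 2 by rewrite divr_gt0.
have [r r0 fr] := fz _ e2; have [q q0 gq] := gz _ e2.
have rq0 : 0 < Num.min r q by rewrite lt_min r0.
have [x xfg zx] := ae_dense fg z rq0.
have /fr/(_ i) : cbox z r x by apply: cbox_le zx; rewrite ge_min lexx.
have /gq/(_ i) : cbox (signed_perm pi s z) q (signed_perm pi s x).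
  by apply: signed_perm_cbox; apply: cbox_le zx; rewrite ge_min lexx orbT.
rewrite -xfg !ler_distl.
move: (f z _ _) (f x _ _) (g _ _ _) => u v w /andP[? ?] /andP[? ?].
by apply/andP; split; lra.
Qed.

(** Exchanging the values of a generator at two points preserves injectivity, differentiability
    almost everywhere and the law. Equality at every point therefore cannot hold in general; it is
    obtained almost everywhere and wherever both sides are continuous. *)
Theorem theorem1 (R : realType) (D N : nat) (D_gt0 : (0 < D)%N)
    (N_gt0 : (0 < N)%N) (Ms M : generative_model R D N)
    (gs_inj : injective (generator Ms)) (g_inj : injective (generator M))
    (gs_diff : {ae lebesgue_rV, forall z, differentiable (generator Ms) z})
    (g_diff : {ae lebesgue_rV, forall z, differentiable (generator M) z})
    (shape_eq : shape_param M = shape_param Ms) (rate_eq : rate_param M = rate_param Ms)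
    (shape_lt2 : shape_param M < 2)
    (law_eq : forall B : set ('rV[R]_N * 'rV[R]_N), measurable B ->
      observation_law Ms B = observation_law M B) :
  exists (pi : 'S_D) (s : 'I_D -> bool),
    {ae lebesgue_rV, forall z : 'rV[R]_D,
      generator M z = generator Ms (signed_perm pi s z)} /\
    (forall z : 'rV[R]_D,
      {for z, continuous (generator M)} ->
      {for signed_perm pi s z, continuous (generator Ms)} ->
      generator M z = generator Ms (signed_perm pi s z)).
Proof.
(* The learned generator plays the part of [f], so that the signed permutation is applied inside the
   true one. *)
have [||B mB|pi [s fg]] := coupled_signed_perm (rate_param_gt0 M)
    (shape_param_gt0 M) shape_lt2 g_inj gs_inj.
- by apply: filterS g_diff => z; exact: differentiable_continuous.
- by apply: filterS gs_diff => z; exact: differentiable_continuous.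
- by have := law_eq B mB; rewrite /observation_law -shape_eq -rate_eq => ->.
by exists pi, s; split => //; exact: ae_eq_continuity_pt.
Qed.
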